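(* For any primitive, binary constant-length substitution $\varrho$, the extremal Lyapunov exponents (of the matrix cocycle $B^{(n)}(k)$ defined by the Fourier matrix $B(k)$ of $\varrho$) are explicitly given by $$\chi^{B}_{\min}=0\quad\text{and}\quad \chi^{B}_{\max}=\mathfrak{m}(p_\varrho),$$ where $p_\varrho$ is a Borwein polynomial, easily determined by $\varrho$. In particular, if $p_\varrho$ is non-reciprocal, one has $\chi^{B}_{\max}\geqslant\log(\lambda_{\mathrm{p}})$, where $\lambda_{\mathrm{p}}$ is the plastic number, i.e. the real root of $z^3-z-1$.
   Context: A binary constant-length substitution $\varrho=(w_0,w_1)$ is a map $0\mapsto w_0$, $1\mapsto w_1$, where $w_0,w_1$ are words over the alphabet $\{0,1\}$ of equal length $L\geqslant 2$. Positions in words are indexed from $0$ to $L-1$. The substitution matrix is $M_\varrho=(m_{ij})_{0\leqslant i,j\leqslant 1}$, with $m_{ij}$ the number of occurrences of the letter $i$ in $w_j$; $\varrho$ is primitive if $M_\varrho$ is a primitive matrix (some power has only strictly positive entries). The Fourier matrix of $\varrho$ is the $2\times 2$ matrix $B(k)=(B_{ij}(k))_{0\leqslant i,j\leqslant 1}$, $k\in\mathbb{R}$, with $B_{ij}(k)=\sum_{m\in T_{ij}} e^{2\pi \mathrm{i} k m}$ ($\mathrm{i}$ the imaginary unit), where $T_{ij}$ is the set of positions $m$ at which the letter $i$ occurs in $w_j$. The cocycle is $B^{(n)}(k)=B(k)B(Lk)\cdots B(L^{n-1}k)$. For each fixed non-zero row vector $v\in\mathbb{C}^2$, the Lyapunov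 exponent $\lim_{n\to\infty}\frac1n\log\|vB^{(n)}(k)\|$ exists for Lebesgue-almost every $k\in\mathbb{R}$ and is constant on a set of full measure; as a function of $v$ it takes at most two values, independent of the choice of norm. The larger and the smaller of these are the extremal Lyapunov exponents $\chi^B_{\max}$ and $\chi^B_{\min}$ (equal if there is only one value). When the cocycle is invertible for almost every $k$, they are also given, for almost every $k$, by $$\chi^B_{\max}=\lim_{n\to\infty}\tfrac1n\log\|B^{(n)}(k)\|,\qquad \chi^B_{\min}=-\lim_{n\to\infty}\tfrac1n\log\|(B^{(n)}(k))^{-1}\|.$$ The logarithmic Mahler measure of a polynomial $p$ is $\mathfrak{m}(p)=\int_0^1\log|p(e^{2\pi \mathrm{i} t})|\,dt$. A Borwein polynomial is a polynomial with all coefficients in $\{-1,0,1\}$ and non-zero constant term. A polynomial $p$ is reciprocal if $p(z)=\pm z^{\deg(p)}p(1/z)$ for some choice of sign, and non-reciprocal otherwise. *)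

(* Defs.v *)
From HB Require Import structures.
From mathcomp Require Import all_boot all_order all_algebra.
From mathcomp Require Import complex.
From mathcomp Require Import all_classical all_reals all_analysis.
Set Implicit Arguments.
Unset Strict Implicit.
Unset Printing Implicit Defensive.
Import Order.TTheory GRing.Theory Num.Theory.
Import numFieldNormedType.Exports.
Local Open Scope classical_set_scope.
Local Open Scope complex_scope.
Local Open Scope ring_scope.

(* The pair (w_0, w_1), as the map j |-> w_j; the alphabet {0, 1} is 'I_2. *)
Definition binary_subst (L : nat) := 'I_2 -> L.-tuple 'I_2.

Definition subst_matrix (L : nat) (rho : binary_subst L) : 'M[nat]_2 :=
  \matrix_(i, j) count_mem i (rho j).

Definition primitive (L : nat) (rho : binary_subst L) : Prop :=
  exists n : nat, forall i j, (0 < (subst_matrix rho ^+ n) i j)%N.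

Definition expi2pi (R : realType) (t : R) : R[i] :=
  cos (2 * pi * t) +i* sin (2 * pi * t).

(* The real-valued modulus; `|z| would live in R[i]. *)
Notation cmod z := (ComplexField.Normc.normc z).

Definition fourier_matrix (R : realType) (L : nat) (rho : binary_subst L)
    (k : R) : 'M[R[i]]_2 :=
  \matrix_(i, j) \sum_(m < L | tnth (rho j) m == i) expi2pi (k * m%:R).

Definition cocycle (R : realType) (L : nat) (rho : binary_subst L)
    (n : nat) (k : R) : 'M[R[i]]_2 :=
  \prod_(j < n) fourier_matrix rho (L%:R ^+ j * k).

(* Exponents do not depend on the norm on C^2; this is the l^1 norm. *)
Definition vnorm (R : realType) (v : 'rV[R[i]]_2) : R :=
  \sum_(i < 2) cmod (v 0 i).

(* Exponents are extended reals, with log 0 = -oo (unlike the total ln). *)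
Definition is_lyapunov_exponent (R : realType) (L : nat)
    (rho : binary_subst L) (v : 'rV[R[i]]_2) (chi : \bar R) : Prop :=
  {ae (@lebesgue_measure R), forall k : R,
    (fun n : nat =>
       (n%:R^-1)%:E * lne (vnorm (v *m cocycle rho n k))%:E)%E @ \oo --> chi}.

(* Every non-zero v has an exponent, the values taken are exactly
   chi_min and chi_max (possibly equal), and chi_min <= chi_max. *)
Definition extremal_lyapunov_exponents (R : realType) (L : nat)
    (rho : binary_subst L) (chi_min chi_max : \bar R) : Prop :=
  [/\ (chi_min <= chi_max)%E,
      forall v : 'rV[R[i]]_2, v != 0 ->
        is_lyapunov_exponent rho v chi_min \/
        is_lyapunov_exponent rho v chi_max,
      exists2 v : 'rV[R[i]]_2, v != 0 & is_lyapunov_exponent rho v chi_min &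
      exists2 v : 'rV[R[i]]_2, v != 0 & is_lyapunov_exponent rho v chi_max].

Definition log_mahler (R : realType) (p : {poly R[i]}) : \bar R :=
  (\int[@lebesgue_measure R]_(t in `[0%R, 1%R])
     lne (cmod p.[expi2pi t])%:E)%E.

Definition is_borwein (A : nzRingType) (p : {poly A}) : Prop :=
  p`_0 != 0 /\ forall i : nat, [\/ p`_i = -1, p`_i = 0 | p`_i = 1].

Definition reciprocal (F : fieldType) (p : {poly F}) : Prop :=
  exists2 e : F, e = 1 \/ e = -1 &
    forall z : F, z != 0 -> p.[z] = e * z ^+ (size p).-1 * p.[z^-1].

(* Evaluated at e^(2 pi i k), this is B_00(k) - B_01(k), the factor by which
   B(k) acts on row vectors modulo its invariant line spanned by (1, 1). *)
Definition diff_poly (A : nzRingType) (L : nat) (rho : binary_subst L)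
    : {poly A} :=
  \sum_(m < L) ((tnth (rho 0) m == 0)%:R - (tnth (rho 1) m == 0)%:R) *: 'X^m.

(* diff_poly divided by the largest possible power of X, which does not change
   the Mahler measure.  If w_0 = w_1, then diff_poly = 0; every non-zero row
   vector then has exponent 0, and the polynomial is taken to be 1. *)
Definition borwein_poly (F : fieldType) (L : nat) (rho : binary_subst L)
    : {poly F} :=
  let d := diff_poly F rho in
  if d == 0 then 1 else drop_poly (mup 0 d) d.

(* Main.v *)
(* The row vector (1, 1) is a left eigenvector of B(k) with eigenvalue
   geo(e(k)) = 1 + e(k) + ... + e((L-1)k), and on the quotient B(k) acts as
   multiplication by d(e(k)), where d is the difference polynomial.  Hence the
   exponents are the almost sure Birkhoff averages of log|geo(e(L^j k))|
   and log|d(e(L^j k))|; the term coupling the two directions is a sum of terms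
   of growth rate at most m(d), which is non-negative.

   For a polynomial with zeros a the averages are computed factor by factor:
   on the circle, |z - a| = max(1, |a|) |1 - beta z| with |beta| <= 1.
   The Fourier coefficients of log|1 - beta z| are O(1/n), so the correlations
   of its iterates under k |-> L k decay geometrically and n-step sums have
   second moment O(n).  Along n = m^2 this gives almost sure convergence of the
   averages to 0 (Fatou's lemma for the truncated Fourier series), and because
   log|1 - beta z| <= log 2 the averages in between are squeezed.  The same
   second moments yield Jensen's formula.

   The plastic number bound is Smyth's theorem.  If A and B collect the linear
   factors of P inside and outside the unit circle, then h = +-P/P^* is an
   integer power series with f = g h, f = A/A^*, g = B^*/B, up to unimodular
   constants.  Multiplication by f and g does not increase the energy
   of truncated coefficient sequences, and f(0) = g(0) = 1/M(P).  Testing this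
   on sparse sequences at the first coefficients where f and g differ gives
   M^-3 + M^-2 <= 1. *)
Require Import Defs.
From HB Require Import structures.
From mathcomp Require Import all_boot all_order all_algebra.
From mathcomp Require Import complex ring lra zify.
From mathcomp Require Import all_classical all_reals all_analysis.
From mathcomp Require Import measurable_realfun.
Set Implicit Arguments.
Unset Strict Implicit.
Unset Printing Implicit Defensive.
Import Order.TTheory GRing.Theory Num.Theory.
Import numFieldNormedType.Exports.
Local Open Scope classical_set_scope.
Local Open Scope complex_scope.
Local Open Scope ring_scope.

(** * Smyth's bound for the Mahler measure of a non-reciprocal polynomial *)

Section PlasticNumerics.
Variable R : realFieldType.
Implicit Types c x y e t s : R.

Lemma psd_discr (a b g : R) : 0 < g ->
  (forall u v : R, 0 <= a * u ^+ 2 + 2 * b * u * v + g * v ^+ 2) -> b ^+ 2 <= a * g.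
Proof.
move=> g0 /(_ g (- b)) H.
have : 0 <= g * (a * g - b ^+ 2).
  by rewrite (le_trans H)// le_eqVlt; apply/orP; left; apply/eqP; ring.
by rewrite pmulr_rge0// subr_ge0.
Qed.

(** In the application x, y are the k-th and c2, d2 the 2k-th coefficients of f and g, in one order
    or the other, and c is their common constant term. The two quadratic bounds, weighted by 1 + c
    and 1 - c, bound c2 - d2 from above; were it at least x, an expression that is positive as soon
    as c^3 + c^2 > 1 would be non-positive. *)
Lemma plastic_consecutive c x y c2 d2 :
  (7 / 10) < c -> c < 1 -> 1 < c ^+ 3 + c ^+ 2 -> x - y = c -> - y <= 1 - c ^+ 2 ->
  c2 * (1 - c) <= (1 - c ^+ 2) * (1 - c) - x ^+ 2 ->
  - d2 * (1 + c) <= (1 - c ^+ 2) * (1 + c) - y ^+ 2 ->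
  c2 - d2 < x.
Proof.
move=> c7 c1 cub xy yA Hc Hd; rewrite ltNge; apply/negP => xle.
(* The slack in - y <= 1 - c^2; below, x and y are both expressed through s and c. *)
pose s := x - c + (1 - c ^+ 2).
have s0 : 0 <= s by rewrite /s; lra.
have H1 : (c2 - d2) * (1 - c ^+ 2) <=
    2 * (1 - c ^+ 2) ^+ 2 - x ^+ 2 * (1 + c) - y ^+ 2 * (1 - c).
  have h1 : c2 * (1 - c) * (1 + c) <= ((1 - c ^+ 2) * (1 - c) - x ^+ 2) * (1 + c).
    by rewrite ler_wpM2r//; lra.
  have h2 : - d2 * (1 + c) * (1 - c) <= ((1 - c ^+ 2) * (1 + c) - y ^+ 2) * (1 - c).
    by rewrite ler_wpM2r//; lra.
  lra.
have A0 : 0 <= 1 - c ^+ 2 by nra.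
have H2 : x * (1 - c ^+ 2) <= (c2 - d2) * (1 - c ^+ 2) by rewrite ler_wpM2r.
have Ex : x = s + c - (1 - c ^+ 2) by rewrite /s; ring.
have Ey : y = s - (1 - c ^+ 2) by rewrite /s; lra.
have : (1 + c) * (c ^+ 3 + c ^+ 2 - 1) + s * ((5 * c - 3) * (c + 1)) + 2 * s ^+ 2 <= 0.
  have := le_trans H2 H1; rewrite Ex Ey => {}H; nra.
have : 0 < (1 + c) * (c ^+ 3 + c ^+ 2 - 1) by rewrite mulr_gt0//; lra.
have : 0 <= s * ((5 * c - 3) * (c + 1)) by rewrite !mulr_ge0//; lra.
have := sqr_ge0 s; lra.
Qed.

(* The second coefficients of f and g cannot differ by y + m c for any integer
   m: for m >= 1 they would be too far apart, and m <= 0 is the mirror image. *)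
Lemma plastic_gap_two c x y c2 d2 (m : int) :
  (7 / 10) < c -> c < 1 -> x - y = c -> x <= 1 - c ^+ 2 -> - y <= 1 - c ^+ 2 ->
  c2 * (1 - c) <= (1 - c ^+ 2) * (1 - c) - x ^+ 2 ->
  - c2 * (1 + c) <= (1 - c ^+ 2) * (1 + c) - x ^+ 2 ->
  d2 * (1 - c) <= (1 - c ^+ 2) * (1 - c) - y ^+ 2 ->
  - d2 * (1 + c) <= (1 - c ^+ 2) * (1 + c) - y ^+ 2 ->
  c2 - d2 = y + m%:~R * c -> c ^+ 3 + c ^+ 2 <= 1.
Proof.
move=> c7 c1 xy xA yA Hc Hc' Hd Hd' E; rewrite leNgt; apply/negP => cub.
have [m1|m0] := leP 1 m.
  have := plastic_consecutive c7 c1 cub xy yA Hc Hd'.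
  have : (1 : R) <= m%:~R by rewrite (ler_int R 1).
  rewrite E => hm; nra.
have hm : m%:~R <= (0 : R) by rewrite (ler_int R m 0); lia.
have := @plastic_consecutive c (- y) (- x) d2 c2 c7 c1 cub.
rewrite !sqrrN !opprK; have -> : - y + x = c by lra.
move=> /(_ erefl xA Hd Hc'); nra.
Qed.

(* 117/155 is just below 0.75487..., the inverse of the plastic number.  The
   margin is thin: the two forms together give |e| < 6/29 = 0.2069..., while
   the first one alone needs e < -0.2075... when c is that small. *)
Lemma plastic_gap_short c e s :
  (117 / 155) < c -> c < 1 -> 1 <= s ->
  (forall u v : R, (s * c + e) * u ^+ 2 + 2 * c * u * v <=
    2 * ((1 - c ^+ 2 - e ^+ 2) * u ^+ 2 + (1 - c ^+ 2) * v ^+ 2 - 2 * e * c * u * v)) ->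
  (forall u v : R, - ((s * c + e) * u ^+ 2 + 2 * c * u * v) <=
    2 * ((1 - c ^+ 2 - e ^+ 2) * u ^+ 2 + (1 - c ^+ 2) * v ^+ 2 - 2 * e * c * u * v)) ->
  False.
Proof.
move=> c7 c1 s1 H1 H2.
pose A := 1 - c ^+ 2.
have AE : A = 1 - c ^+ 2 by [].
have A0 : 0 < A by rewrite AE; clear -c7 c1; nra.
have D1 : (- 2 * e * c - c) ^+ 2 <= (2 * (A - e ^+ 2) - (s * c + e)) * (2 * A).
  apply: psd_discr => [|u v]; [by clear -A0; lra | have := H1 u v].
  by rewrite AE; clear; lra.
have D2 : (- 2 * e * c + c) ^+ 2 <= (2 * (A - e ^+ 2) + (s * c + e)) * (2 * A).
  apply: psd_discr => [|u v]; [by clear -A0; lra | have := H2 u v].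
  by rewrite AE; clear; lra.
have Al : A < (37 / 86) by rewrite AE; clear -c7; nra.
(* Adding [D1] and [D2] cancels s, and A + c^2 = 1 leaves a bound on e alone. *)
have te : e ^+ 2 <= A ^+ 2 - c ^+ 2 / 4.
  by move: D1 D2; rewrite AE; clear; nra.
have t1 : (- e) ^+ 2 <= (6 / 29) ^+ 2.
  have A2 : A ^+ 2 <= (37 / 86) ^+ 2.
    by rewrite ler_pXn2r ?nnegrE ?ltW// ?(lt_trans A0 Al).
  by rewrite sqrrN; clear -te A2 Al AE; lra.
have {}t1 : - e <= (6 / 29).
  rewrite leNgt; apply/negP => h; have : (6 / 29) ^+ 2 < (- e) ^+ 2.
    by rewrite ltr_pXn2r// nnegrE; clear -h; lra.
  by rewrite ltNge t1.
have {}D1 : (- 2 * e * c - c) ^+ 2 <= (2 * (A - e ^+ 2) - (c + e)) * (2 * A).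
  apply: le_trans D1 _; apply: ler_wpM2r; first by rewrite mulr_ge0// ltW.
  have : c <= s * c by rewrite ler_peMl//; clear -c7; lra.
  by clear; lra.
pose t := - e; have et : e = - t by rewrite /t opprK.
have D3 : 4 * t ^+ 2 - (2 + 2 * c ^+ 2) * t + c ^+ 2 + 2 * A * c - 4 * A ^+ 2 <= 0.
  by move: D1; rewrite et AE; clear; lra.
(* The quadratic polynomial in t of [D3] is decreasing up to 6/29, so it is non-positive there too;
   this eliminates t. *)
have D4 : 4 * (6 / 29) ^+ 2 - (2 + 2 * c ^+ 2) * (6 / 29)
    + c ^+ 2 + 2 * A * c - 4 * A ^+ 2 <= 0.
  have : 0 <= (6 / 29 - t) * (2 + 2 * c ^+ 2 - 4 * (6 / 29 + t)).
    rewrite mulr_ge0//; first by rewrite /t; clear -t1; lra.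
    by move: t1 (sqr_ge0 c); rewrite -/t; clear; lra.
  by move: D3; clear; lra.
have Ac : A * (117 / 155) <= A * c by rewrite ler_wpM2l// ltW.
have A2 : A * A <= A * (37 / 86) by rewrite ler_wpM2l// ltW.
have Ec : c ^+ 2 = 1 - A by rewrite AE; ring.
by rewrite Ec in D4; move: D4 Ac A2 Al A0; clear; lra.
Qed.
End PlasticNumerics.

(** * Hankel forms and the first coefficients where f and g differ *)

Section SmythCore.
Variable R : realFieldType.
Implicit Types (f g x : {poly R}) (h : {poly int}).

(** The coefficient is the quadratic form with Hankel matrix f_(N-i-j) at (x_0, ..., x_N); the
    condition says that this matrix has norm at most 1. *)
Definition hankel_bounded (N : nat) f := forall x,
  `|(f * x ^+ 2)`_N| <= \sum_(i < N.+1) x`_i ^+ 2.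

Definition sparse (s : seq (nat * R)) : {poly R} := \sum_(p <- s) p.2 *: 'X^(p.1).

Lemma coef_sparse0 s i : i \notin unzip1 s -> (sparse s)`_i = 0.
Proof.
elim: s => [|p s IH]; rewrite /sparse ?big_nil ?coef0// big_cons.
rewrite /= inE negb_or => /andP[ip /IH si].
by rewrite coefD si coefZ coefXn (negbTE ip) mulr0 addr0.
Qed.

Lemma sum_sqr_sparse N s : uniq (unzip1 s) -> all (ltn^~ N) (unzip1 s) ->
  \sum_(i < N) (sparse s)`_i ^+ 2 = \sum_(p <- s) p.2 ^+ 2.
Proof.
elim: s => [|[k a] s IH] /=.
  by rewrite /sparse !big_nil big1// => i _; rewrite coef0 expr0n.
move=> /andP[ks us] /andP[kN aN].
rewrite big_cons -(IH us aN) /sparse big_cons.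
have E i : ((a *: 'X^k + \sum_(j <- s) j.2 *: 'X^(j.1))`_i) ^+ 2 =
    a ^+ 2 * (i == k)%:R + (sparse s)`_i ^+ 2.
  rewrite coefD coefZ coefXn -/(sparse s); case: eqVneq => [->|_].
    by rewrite (coef_sparse0 ks) expr0n /= !mulr1 !addr0.
  by rewrite !mulr0 !add0r.
rewrite (eq_bigr _ (fun (i : 'I_N) _ => E i)) big_split /=; congr (_ + _).
rewrite (bigD1 (Ordinal kN))//= eqxx mulr1 big1 ?addr0// => i.
by rewrite -val_eqE /= => /negbTE ->; rewrite mulr0.
Qed.

Lemma hankel_sparse N f s : hankel_bounded N f ->
  uniq (unzip1 s) -> all (ltn^~ N.+1) (unzip1 s) ->
  `|(f * sparse s ^+ 2)`_N| <= \sum_(p <- s) p.2 ^+ 2.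
Proof. by move=> H us al; rewrite -(sum_sqr_sparse us al); apply: H. Qed.

Lemma hankel_pair N f u v : (0 < N)%N -> hankel_bounded N f ->
  `|f`_N * u ^+ 2 + 2 * f`_0 * u * v| <= u ^+ 2 + v ^+ 2.
Proof.
move=> N0 H.
have := @hankel_sparse N f [:: (0%N, u); (N, v)] H.
rewrite /= inE eq_sym -lt0n N0 /= ltnSn => /(_ isT isT).
rewrite /sparse !big_cons !big_nil /= !addr0 expr0 => H1; apply: le_trans H1.
rewrite le_eqVlt; apply/orP; left; apply/eqP; congr `|_|.
have -> : f * (u *: 1 + v *: 'X^N) ^+ 2 =
    u ^+ 2 *: f + (2 * u * v) *: (f * 'X^N) + v ^+ 2 *: (f * 'X^(N + N)).
  by rewrite exprD -!mul_polyC ?rmorphM ?rmorph_nat ?rmorphXn /=; ring.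
rewrite !coefD !coefZ !coefMXn ltnn subnn.
have -> : (N < N + N)%N by lia.
ring.
Qed.

Lemma hankel_triple k f u v w : (0 < k)%N -> hankel_bounded (k + k) f ->
  `|f`_(k + k) * u ^+ 2 + 2 * f`_k * u * v + f`_0 * v ^+ 2 + 2 * f`_0 * u * w|
     <= u ^+ 2 + v ^+ 2 + w ^+ 2.
Proof.
move=> k0 H.
have := @hankel_sparse _ f [:: (0%N, u); (k, v); (k + k, w)%N] H.
have -> : uniq (unzip1 [:: (0%N, u); (k, v); (k + k, w)%N]).
  by rewrite /= !inE; lia.
have -> : all (ltn^~ (k + k).+1) (unzip1 [:: (0%N, u); (k, v); (k + k, w)%N]).
  by rewrite /=; lia.
move=> /(_ isT isT).
rewrite /sparse !big_cons !big_nil /= !addr0 expr0 !addrA => H1; apply: le_trans H1.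
rewrite le_eqVlt; apply/orP; left; apply/eqP; congr `|_|.
have -> : f * (u *: 1 + v *: 'X^k + w *: 'X^(k + k)) ^+ 2 =
    u ^+ 2 *: f + (2 * u * v) *: (f * 'X^k) + (v ^+ 2 + 2 * u * w) *: (f * 'X^(k + k))
    + (2 * v * w) *: (f * 'X^(k + k + k)) + (w ^+ 2) *: (f * 'X^(k + k + k + k)).
  by rewrite !exprD -!mul_polyC ?(rmorphXn, rmorphD, rmorphM, rmorph_nat) /=; ring.
rewrite !coefD !coefZ !coefMXn ltnn subnn addnK.
have -> : (k + k < k)%N = false by lia.
have -> : (k + k < k + k + k)%N by lia.
have -> : (k + k < k + k + k + k)%N by lia.
ring.
Qed.

Lemma hankel_quad j k f u0 u1 u2 u3 : (0 < j)%N -> (j < k)%N ->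
  hankel_bounded (j + k) f ->
  `|f`_(j + k) * u0 ^+ 2 + 2 * f`_k * u0 * u1 + f`_(k - j) * u1 ^+ 2
    + 2 * f`_j * u0 * u2 + 2 * f`_0 * u0 * u3 + 2 * f`_0 * u1 * u2|
     <= u0 ^+ 2 + u1 ^+ 2 + u2 ^+ 2 + u3 ^+ 2.
Proof.
move=> j0 jk H.
have := @hankel_sparse _ f [:: (0%N, u0); (j, u1); (k, u2); (j + k, u3)%N] H.
have -> : uniq (unzip1 [:: (0%N, u0); (j, u1); (k, u2); (j + k, u3)%N]).
  by rewrite /= !inE; lia.
have -> : all (ltn^~ (j + k).+1) (unzip1 [:: (0%N, u0); (j, u1); (k, u2); (j + k, u3)%N]).
  by rewrite /=; lia.
move=> /(_ isT isT).
rewrite /sparse !big_cons !big_nil /= !addr0 expr0 !addrA => H1; apply: le_trans H1.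
rewrite le_eqVlt; apply/orP; left; apply/eqP; congr `|_|.
have -> : f * (u0 *: 1 + u1 *: 'X^j + u2 *: 'X^k + u3 *: 'X^(j + k)) ^+ 2 =
    u0 ^+ 2 *: f + (2 * u0 * u1) *: (f * 'X^j) + u1 ^+ 2 *: (f * 'X^(j + j))
    + (2 * u0 * u2) *: (f * 'X^k) + (2 * u0 * u3 + 2 * u1 * u2) *: (f * 'X^(j + k))
    + (2 * u1 * u3) *: (f * 'X^(j + j + k)) + (u2 ^+ 2) *: (f * 'X^(k + k))
    + (2 * u2 * u3) *: (f * 'X^(j + k + k)) + (u3 ^+ 2) *: (f * 'X^(j + j + k + k)).
  by rewrite !exprD -!mul_polyC ?(rmorphXn, rmorphD, rmorphM, rmorph_nat) /=; ring.
rewrite !coefD !coefZ !coefMXn ltnn subnn addnK addKn subnDl.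
have -> : (j + k < j)%N = false by lia.
have -> : (j + k < j + j)%N = false by lia.
have -> : (j + k < k)%N = false by lia.
have -> : (j + k < j + j + k)%N by lia.
have -> : (j + k < k + k)%N by lia.
have -> : (j + k < j + k + k)%N by lia.
have -> : (j + k < j + j + k + k)%N by lia.
ring.
Qed.

(** For u = 1 the choices v = c and v = - c, with c the constant term of f, are optimal in
    [hankel_pair]. *)
Lemma hankel_coef_bound N f : (0 < N)%N -> hankel_bounded N f ->
  `|f`_N| <= 1 - f`_0 ^+ 2.
Proof.
move=> N0 H; rewrite ler_norml.
have := hankel_pair 1 (f`_0) N0 H; have := hankel_pair 1 (- f`_0) N0 H.
by rewrite !ler_norml => /andP[h1 _] /andP[_ h2]; lra.
Qed.

(** The optimal test vectors in [hankel_triple] with first entry 1: (1, f_k / (1 - c), c) for the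
    upper bound, (1, - f_k / (1 + c), - c) for the lower one. *)
Lemma hankel_double_coef k f : (0 < k)%N -> 0 < f`_0 -> f`_0 < 1 ->
  hankel_bounded (k + k) f ->
  f`_(k + k) * (1 - f`_0) <= (1 - f`_0 ^+ 2) * (1 - f`_0) - f`_k ^+ 2 /\
  - f`_(k + k) * (1 + f`_0) <= (1 - f`_0 ^+ 2) * (1 + f`_0) - f`_k ^+ 2.
Proof.
set c := f`_0 => k0 c0 c1 H.
have d1 : 1 - c != 0 by rewrite subr_eq0 eq_sym lt_eqF.
have d2 : 1 + c != 0 by rewrite lt0r_neq0// addr_gt0.
have := hankel_triple 1 (f`_k / (1 - c)) c k0 H.
have := hankel_triple 1 (- (f`_k / (1 + c))) (- c) k0 H.
rewrite -/c !ler_norml => /andP[h1 _] /andP[_ h2]; split.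
  have {}h2 : f`_(k + k) <= (1 - c ^+ 2) - f`_k ^+ 2 / (1 - c).
    have E : f`_k ^+ 2 / (1 - c) = 2 * f`_k * (f`_k / (1 - c))
      + c * (f`_k / (1 - c)) ^+ 2 - (f`_k / (1 - c)) ^+ 2 by field.
    by rewrite E; lra.
  have := ler_wpM2r (ltW (_ : 0 < 1 - c)) h2; rewrite subr_gt0 => /(_ c1).
  by rewrite mulrBl divfK.
have {}h1 : - f`_(k + k) <= (1 - c ^+ 2) - f`_k ^+ 2 / (1 + c).
  have E : f`_k ^+ 2 / (1 + c) = 2 * f`_k * (f`_k / (1 + c))
    - c * (f`_k / (1 + c)) ^+ 2 - (f`_k / (1 + c)) ^+ 2 by field.
  by rewrite E; lra.
have := ler_wpM2r (ltW (_ : 0 < 1 + c)) h1; rewrite addr_gt0// => /(_ isT).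
by rewrite mulrBl divfK.
Qed.

Local Notation toR h := (map_poly (intr : int -> R) h).

Lemma coef_mul_int g h i : (toR h * g)`_i = \sum_(m < i.+1) (h`_m)%:~R * g`_(i - m).
Proof. by rewrite coefM; apply: eq_bigr => m _; rewrite coef_map. Qed.

Lemma coef_mul_int_first g h n : (0 < n)%N -> h`_0 = 1 ->
  (forall i, (0 < i < n)%N -> h`_i = 0) ->
  (toR h * g)`_n = g`_n + (h`_n)%:~R * g`_0.
Proof.
move=> n0 h0 hz; rewrite coef_mul_int.
rewrite (bigD1 ord0)//= (bigD1 ord_max) /=; last by rewrite -val_eqE /=; lia.
rewrite h0 mul1r subn0 subnn big1 ?addr0// => i; rewrite -!val_eqE /= => ni.
by rewrite hz ?mul0r//; have := ltn_ord i; lia.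
Qed.

Lemma coef_mul_int_second g h k n : (0 < k < n)%N -> h`_0 = 1 ->
  (forall i, (0 < i < n)%N -> i != k -> h`_i = 0) ->
  (toR h * g)`_n = g`_n + (h`_k)%:~R * g`_(n - k) + (h`_n)%:~R * g`_0.
Proof.
move=> /andP[k0 kn] h0 hz; rewrite coef_mul_int.
have kn1 : (k < n.+1)%N by lia.
rewrite (bigD1 ord0)//= (bigD1 ord_max) /=; last by rewrite -val_eqE /=; lia.
rewrite (bigD1 (Ordinal kn1)) /=; last by rewrite -!val_eqE /=; lia.
rewrite h0 mul1r subn0 subnn big1 ?addr0; last first.
  move=> i; rewrite -!val_eqE /= => ni.
  by rewrite hz ?mul0r//; have := ltn_ord i; lia.
by rewrite addrA addrAC.
Qed.

(* g plays the part of B^*/B and toR h * g that of A/A^*, where A and B collect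
   the zeros inside and outside the unit circle; g(0) is the inverse of the
   Mahler measure. *)
Theorem smyth_core g h (k : nat) :
  (0 < k)%N -> h`_0 = 1 -> h`_k != 0 ->
  (forall i, (0 < i < k)%N -> h`_i = 0) ->
  0 < g`_0 ->
  (forall N, (N <= k + k)%N -> hankel_bounded N g) ->
  (forall N, (N <= k + k)%N -> hankel_bounded N (toR h * g)) ->
  g`_0 ^+ 3 + g`_0 ^+ 2 <= 1.
Proof.
move=> k0 h0 hk hlow c0 Hg Hf; set f := toR h * g in Hf.
set c := g`_0 in c0 *.
have fg_low i : (i < k)%N -> f`_i = g`_i.
  move=> ik; rewrite coef_mul_int big_ord_recl h0 mul1r subn0 big1 ?addr0// => m _.
  by rewrite hlow ?mul0r//= /bump leq0n add1n; have := ltn_ord m; lia.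
have f0 : f`_0 = c by rewrite fg_low.
have fk : f`_k = g`_k + (h`_k)%:~R * c by apply: coef_mul_int_first.
rewrite leNgt; apply/negP => cub.
have fkb : `|f`_k| <= 1 - c ^+ 2 by rewrite -f0 hankel_coef_bound//; apply: Hf; lia.
have gkb : `|g`_k| <= 1 - c ^+ 2 by rewrite hankel_coef_bound//; apply: Hg; lia.
(* As h_k is a non-zero integer, f_k and g_k are at least c apart, whereas both have modulus at most
   1 - c^2. *)
have c1 : c < 1.
  have : c <= `|(h`_k)%:~R * c|.
    rewrite normrM (gtr0_norm c0); apply: ler_peMl; first exact: ltW.
    by rewrite -intr_norm ler1z; lia.
  have -> : (h`_k)%:~R * c = f`_k - g`_k by rewrite fk; ring.
  move=> /le_trans /(_ (ler_normB _ _)) => h1.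
  have : c <= 2 * (1 - c ^+ 2) by move: h1 fkb gkb; clear; lra.
  by move: c0; clear; nra.
(* For c at most 117/155 the claim c^3 + c^2 <= 1 holds already. *)
have c7 : 117 / 155 < c.
  rewrite ltNge; apply/negP => cle; move: cub; rewrite ltNge => /negP; apply.
  have c2 : c ^+ 2 <= (117 / 155) ^+ 2 by rewrite ler_pXn2r// nnegrE; move: c0; clear; lra.
  have : c ^+ 3 <= (117 / 155) ^+ 3 by rewrite ler_pXn2r// nnegrE; move: c0; clear; lra.
  by move: c2; clear; lra.
have hk1 : h`_k = 1 \/ h`_k = -1.
  have : `|(h`_k)%:~R * c| < 2 * c.
    have -> : (h`_k)%:~R * c = f`_k - g`_k by rewrite fk; ring.
    apply: le_lt_trans (ler_normB _ _) _.
    have : 1 - c ^+ 2 < c by move: c7; clear; nra.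
    by move: fkb gkb; clear; lra.
  rewrite normrM (gtr0_norm c0) ltr_pM2r// -intr_norm -[2]/(2%:~R) ltr_int; lia.
move: fkb gkb; rewrite !ler_norml => /andP[fkl fku] /andP[gkl gku].
(* Either h has a non-zero coefficient strictly between k and 2k, which is contradictory by
   [plastic_gap_short], or f and g are compared at k and 2k by [plastic_gap_two]. *)
have [/hasP[l lr hl]|/hasPn nl] :=
    boolP (has (fun l => h`_l != 0) (iota k.+1 (k.-1))).
  have [l0 [lk hl0 lmin]] : exists l0, [/\ (k < l0 < k + k)%N, h`_l0 != 0 &
      forall i, (k < i < l0)%N -> h`_i = 0].
    have ex : exists l0, (k < l0)%N && (h`_l0 != 0).
      by exists l; rewrite hl andbT; move: lr; rewrite mem_iota; clear; lia.
    case: (ex_minnP ex) => l0 /andP[kl hl0] lmin; exists l0; split => //.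
      by have := lmin l; rewrite hl andbT; move: lr kl k0; rewrite mem_iota; clear; lia.
    move=> i /andP[ki il]; apply/eqP; apply: contraTT il => hi.
    by rewrite -leqNgt lmin// ki hi.
  pose j := (l0 - k)%N.
  have El : l0 = (j + k)%N by rewrite /j; clear -lk; lia.
  have j0 : (0 < j)%N by rewrite /j; clear -lk; lia.
  have jk : (j < k)%N by rewrite /j; clear -lk; lia.
  have fl : f`_(j + k) = g`_(j + k) + (h`_k)%:~R * g`_j + (h`_(j + k))%:~R * c.
    rewrite /f (@coef_mul_int_second _ _ k) ?addnK//; first by clear -k0 j0; lia.
    move=> i ijk ik; have [ik'|ik'] := ltnP i k.
      by rewrite hlow//; clear -ijk ik'; lia.
    by apply: lmin; clear -ijk ik ik' El; lia.
  set e := g`_j in fl.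
  have jkk : (j + k <= k + k)%N by clear -jk; lia.
  have Hgl := hankel_quad _ _ _ _ j0 jk (Hg _ jkk).
  have Hfl := hankel_quad _ _ _ _ j0 jk (Hf _ jkk).
  rewrite (fg_low _ jk) (fg_low (k - j)%N) ?f0 in Hfl; last by clear -j0 jk; lia.
  (* For given u, v the other two coordinates are the optimal ones, taken with opposite signs for f
     and g. In the sum of the two inequalities the coefficients of g of index j + k, k and k - j
     cancel and only the contribution of h remains. *)
  have up a u v : a = 1 \/ a = -1 -> a * (((h`_k)%:~R * e + (h`_(j + k))%:~R * c) * u ^+ 2
      + 2 * (h`_k)%:~R * c * u * v) <=
     2 * ((1 - c ^+ 2 - e ^+ 2) * u ^+ 2 + (1 - c ^+ 2) * v ^+ 2 - 2 * e * c * u * v).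
    move=> a1.
    have {}Hfl := Hfl u v (a * (e * u + c * v)) (a * (c * u)).
    have {}Hgl := Hgl u v (- a * (e * u + c * v)) (- a * (c * u)).
    rewrite -/e -/c in Hfl Hgl.
    move: Hfl Hgl; rewrite !ler_norml fl fk => /andP[f1 f2] /andP[g1 g2].
    case: a1 => Ea; rewrite Ea in f1 f2 g1 g2 *.
      by move: f2 g1; clear; lra.
    by move: f1 g2; clear; lra.
  have hl1 : (h`_(j + k) >= 1) || (h`_(j + k) <= -1) by move: hl0; rewrite El; clear; lia.
  have [b [t [b1 t1 bs te]]] : exists b t : R, [/\ b = 1 \/ b = -1, t = 1 \/ t = -1,
      1 <= b * (h`_(j + k))%:~R & (h`_k)%:~R = t].
    have ht : (h`_k)%:~R = 1 :> R \/ (h`_k)%:~R = -1 :> R.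
      by case: hk1 => ->; [left|right].
    case/orP: hl1 => hl1.
      by exists 1, (h`_k)%:~R; rewrite mul1r ler1z; split => //; left.
    exists (-1), (h`_k)%:~R; rewrite mulN1r -mulrNz ler1z; split => //; first by right.
    by clear -hl1; lia.
  rewrite te in up.
  (* The sign changes e -> b t e and v -> b t v normalise h_k to 1 and make the coefficient of index
     j + k positive. *)
  apply: (plastic_gap_short (e := b * t * e) (s := b * (h`_(j + k))%:~R) c7 c1 bs) => u v.
    have := up b u (b * t * v) b1.
    by case: b1 => ->; case: t1 => ->; clear; lra.
  have bN : - b = 1 \/ - b = -1 by case: b1 => ->; [right|left; rewrite opprK].
  have := up (- b) u (b * t * v) bN.
  by case: b1 => ->; case: t1 => ->; clear; lra.
have f2 : f`_(k + k) = g`_(k + k) + (h`_k)%:~R * g`_k + (h`_(k + k))%:~R * c.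
  rewrite /f (@coef_mul_int_second _ _ k) ?addnK//; first by lia.
  move=> i ijk ik; have [ik'|ik'] := ltnP i k; first by rewrite hlow//; lia.
  by apply/eqP; have := nl i; rewrite mem_iota negbK; apply; lia.
have := hankel_double_coef k0 _ _ (Hf _ (leqnn _)).
rewrite f0 => /(_ c0 c1)[F1 F2].
have [G1 G2] := hankel_double_coef k0 c0 c1 (Hg _ (leqnn _)).
rewrite -/c in G1 G2.
move: cub; rewrite ltNge => /negP; apply.
have c7' : 7 / 10 < c by move: c7; clear; lra.
case: hk1 => hk1; rewrite hk1 in fk f2.
  apply: (@plastic_gap_two _ c f`_k g`_k f`_(k + k) g`_(k + k) (h`_(k + k))) => //.
  - by rewrite fk; ring.
  - by move: gkl; clear; lra.
  - by rewrite f2; ring.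
(* For h_k = -1 the roles of f and g are exchanged. Substituting g_k = f_k + c in the difference at
   2k turns the multiple of c into 1 - h_2k. *)
apply: (@plastic_gap_two _ c g`_k f`_k g`_(k + k) f`_(k + k) (1 - h`_(k + k))) => //.
- by rewrite fk; ring.
- by move: fkl; clear; lra.
- by rewrite f2 fk rmorphB /=; ring.
Qed.
End SmythCore.

(** * Power series modulo X^N *)

Section CoefMod.
Variable K : comUnitRingType.
Implicit Types p q r : {poly K}.

(** Congruence modulo X^N. Power series are represented by polynomials up to this congruence, for
    which a polynomial with unit constant term is invertible. *)
Definition eqcoef (N : nat) p q := forall i, (i < N)%N -> p`_i = q`_i.

Lemma eqcoefM N r p q : eqcoef N p q -> eqcoef N (r * p) (r * q).
Proof.
move=> pq i iN; rewrite !coefM; apply: eq_bigr => j _; rewrite pq//.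
by apply: leq_ltn_trans iN; exact: leq_subr.
Qed.

Lemma eqcoef_trans N p q r : eqcoef N p q -> eqcoef N q r -> eqcoef N p r.
Proof. by move=> pq qr i iN; rewrite pq// qr. Qed.

Lemma eqcoef_sym N p q : eqcoef N p q -> eqcoef N q p.
Proof. by move=> pq i iN; rewrite pq. Qed.

Lemma eqcoefMI N r p q : r`_0 \is a GRing.unit ->
  eqcoef N (r * p) (r * q) -> eqcoef N p q.
Proof.
move=> ru H; elim/ltn_ind => i IH iN; have := H _ iN.
rewrite !coefM !big_ord_recl /= subn0.
rewrite (eq_bigr (fun j : 'I_i => r`_(bump 0 j) * q`_(i - bump 0 j))).
  by move=> /addIr /(mulrI ru).
move=> j _; rewrite IH// /bump leq0n add1n; have := ltn_ord j; lia.
Qed.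

Lemma eqcoef_inv N r : r`_0 \is a GRing.unit -> exists s, eqcoef N (r * s) 1.
Proof.
move=> ru; elim: N => [|N [s IH]]; first by exists 0.
exists (s + ((r`_0)^-1 * ((1 : {poly K})`_N - (r * s)`_N)) *: 'X^N) => i.
rewrite ltnS mulrDr coefD -scalerAr coefZ coefMXn leq_eqVlt => /orP[/eqP ->|iN].
  by rewrite ltnn subnn mulrAC mulVr// mul1r addrC subrK.
by rewrite iN mulr0 addr0 IH.
Qed.

End CoefMod.

(** The form is the scalar product of the truncation of f x with the reversed truncation of x, and
    neither vector is longer than that of x. *)
Lemma contraction_hankel (R : realFieldType) (N : nat) (f : {poly R}) :
  (forall x : {poly R}, \sum_(i < N.+1) (f * x)`_i ^+ 2 <= \sum_(i < N.+1) x`_i ^+ 2) ->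
  hankel_bounded N f.
Proof.
move=> H x; have -> : f * x ^+ 2 = (f * x) * x by ring.
rewrite coefM; apply: le_trans (ler_norm_sum _ _ _) _.
have E2 : \sum_(i < N.+1) x`_(N - i) ^+ 2 = \sum_(i < N.+1) x`_i ^+ 2.
  by rewrite [RHS](reindex_inj rev_ord_inj).
have h (i : 'I_N.+1) : `|(f * x)`_i * x`_(N - i)| <=
    2^-1 * ((f * x)`_i ^+ 2 + x`_(N - i) ^+ 2).
  move: (_`_i) (_`_(N - i)) => a b; rewrite ler_norml.
  by have := sqr_ge0 (a + b); have := sqr_ge0 (a - b); lra.
apply: le_trans (ler_sum _ (fun i _ => h i)) _; rewrite -mulr_sumr big_split /= E2.
by have := H x; lra.
Qed.

(** * Energy of truncated sequences under Blaschke factors *)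

Section Blaschke.
Variable R : rcfType.
Local Notation C := R[i].
Implicit Types (a z w : C) (x y : {poly C}) (s : seq C).

Definition sqmod z : R := complex.Re z ^+ 2 + complex.Im z ^+ 2.

Lemma sqmodM z w : sqmod (z * w) = sqmod z * sqmod w.
Proof. by case: z w => [? ?] [? ?]; rewrite /sqmod /=; ring. Qed.

Lemma sqmod_ge0 z : 0 <= sqmod z.
Proof. by rewrite addr_ge0 ?sqr_ge0. Qed.

Lemma sqmodE z : sqmod z = ComplexField.Normc.normc z ^+ 2.
Proof. by case: z => a b /=; rewrite sqr_sqrtr ?sqmod_ge0// addr_ge0 ?sqr_ge0. Qed.

Lemma conjc_mul_self z : z * z^* = (sqmod z)%:C.
Proof.
case: z => a b; rewrite /sqmod; apply/eqP; rewrite eq_complex /=.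
by apply/andP; split; apply/eqP; ring.
Qed.

Definition lin a : {poly C} := 'X - a%:P.
(** The quotient of [lin a] by [star a] is the Blaschke factor with zero a. *)
Definition star a : {poly C} := 1 - (a^*) *: 'X.
Definition energy (N : nat) x : R := \sum_(i < N) sqmod x`_i.

Lemma coef_star_mul a y n :
  (star a * y)`_n = y`_n - a^* * (if n is m.+1 then y`_m else 0).
Proof.
rewrite /star mulrBl mul1r coefB -scalerAl coefZ coefXM.
by case: n => //=; rewrite mulr0.
Qed.

Lemma coef_lin_mul a x n :
  (lin a * x)`_n = (if n is m.+1 then x`_m else 0) - a * x`_n.
Proof. by rewrite /lin mulrBl coefB coefCM coefXM; case: n. Qed.

(** The identity [key] telescopes along the recursion y_(n+1) + a x_(n+1) = a^* y_n + x_n. The sign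
    of 1 - |a|^2 then decides which of x and y has the larger energy, so one identity serves zeros
    inside and outside the circle. *)
Lemma energy_blaschke a x y N : eqcoef N.+1 (star a * y) (lin a * x) ->
  (1 - sqmod a) * (energy N.+1 x - energy N.+1 y) = sqmod (a^* * y`_N + x`_N).
Proof.
have key z w : (1 - sqmod a) * (sqmod w - sqmod z) =
    sqmod (a^* * z + w) - sqmod (z + a * w).
  by case: a z w => [? ?] [? ?] [? ?]; rewrite /sqmod /=; ring.
elim: N => [|N IH] H.
  have := H 0 isT; rewrite coef_star_mul coef_lin_mul mulr0 subr0 sub0r => y0.
  by rewrite /energy !big_ord1 key y0 addNr /sqmod /= expr0n/= !addr0 subr0.
have := H N.+1 (ltnSn _); rewrite coef_star_mul coef_lin_mul => yN.
have ES (w : {poly C}) : energy N.+2 w = energy N.+1 w + sqmod w`_N.+1.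
  by rewrite /energy big_ord_recr.
have E4 (p q r t : R) : p + q - (r + t) = (p - r) + (q - t) by ring.
rewrite !ES E4 mulrDr IH ?key; last by move=> i iN; apply: H; rewrite ltnW.
suff -> : y`_N.+1 + a * x`_N.+1 = a^* * y`_N + x`_N by rewrite addrC subrK.
by rewrite -[y`_N.+1](subrK (a^* * y`_N)) yN; ring.
Qed.

Lemma energy_inner a x y N : sqmod a < 1 -> eqcoef N (star a * y) (lin a * x) ->
  energy N y <= energy N x.
Proof.
case: N => [|N] a1 H; first by rewrite /energy !big_ord0.
by rewrite -subr_ge0 -(pmulr_rge0 _ (_ : 0 < 1 - sqmod a)) ?subr_gt0// energy_blaschke ?sqmod_ge0.
Qed.

Lemma energy_outer a x y N : 1 < sqmod a -> eqcoef N (lin a * y) (star a * x) ->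
  energy N y <= energy N x.
Proof.
case: N => [|N] a1 /eqcoef_sym H; first by rewrite /energy !big_ord0.
rewrite -subr_le0 -(nmulr_rge0 _ (_ : 1 - sqmod a < 0)) ?subr_lt0//.
by rewrite energy_blaschke ?sqmod_ge0.
Qed.

Lemma star0 a : (star a)`_0 = 1.
Proof. by rewrite /star coefB coef1 coefZ coefX mulr0 subr0. Qed.

Lemma lin0 a : (lin a)`_0 = - a.
Proof. by rewrite /lin coefB coefX coefC sub0r. Qed.

Lemma coef0_prod s (F : C -> {poly C}) :
  (\prod_(a <- s) F a)`_0 = \prod_(a <- s) (F a)`_0.
Proof.
elim: s => [|a s IH]; first by rewrite !big_nil coef1.
by rewrite !big_cons coef0M IH.
Qed.

Lemma sqmod_gt0_unit a : 0 < sqmod a -> a \is a GRing.unit.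
Proof.
by rewrite unitfE; apply: contraTneq => ->; rewrite /sqmod /= expr0n addr0 ltxx.
Qed.

(** The factors are removed one at a time: w inverts [star a] modulo X^N, and the series w (lin a) x
    lies between y and x in energy. *)
Lemma energy_inner_prod s x y N : {in s, forall a, sqmod a < 1} ->
  eqcoef N (\prod_(a <- s) star a * y) (\prod_(a <- s) lin a * x) ->
  energy N y <= energy N x.
Proof.
elim: s x => [|a s IH] x hs.
  rewrite !big_nil !mul1r => H; apply: ler_sum => i _.
  by rewrite H.
rewrite !big_cons => H.
have au : (star a)`_0 \is a GRing.unit by rewrite star0 unitr1.
have [w Hw] := eqcoef_inv N au.
have Hz : eqcoef N (star a * (w * (lin a * x))) (lin a * x).
  rewrite mulrA [X in eqcoef _ X]mulrC -[X in eqcoef _ _ X]mulr1.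
  exact: eqcoefM.
apply: le_trans (energy_inner _ Hz); last by apply: hs; rewrite inE eqxx.
apply: IH => [b bs|]; first by apply: hs; rewrite inE bs orbT.
apply: (eqcoefMI au); rewrite mulrA; apply: eqcoef_trans H _.
rewrite [X in eqcoef _ X]mulrAC [X in eqcoef _ _ X]mulrCA mulrC.
exact/eqcoefM/eqcoef_sym.
Qed.

Lemma energy_outer_prod s x y N : {in s, forall a, 1 < sqmod a} ->
  eqcoef N (\prod_(a <- s) lin a * y) (\prod_(a <- s) star a * x) ->
  energy N y <= energy N x.
Proof.
elim: s x => [|a s IH] x hs.
  rewrite !big_nil !mul1r => H; apply: ler_sum => i _.
  by rewrite H.
rewrite !big_cons => H.
have a1 : 1 < sqmod a by apply: hs; rewrite inE eqxx.
have au : (lin a)`_0 \is a GRing.unit.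
  by rewrite lin0 unitrN sqmod_gt0_unit// (lt_trans ltr01).
have [w Hw] := eqcoef_inv N au.
have Hz : eqcoef N (lin a * (w * (star a * x))) (star a * x).
  rewrite mulrA [X in eqcoef _ X]mulrC -[X in eqcoef _ _ X]mulr1.
  exact: eqcoefM.
apply: le_trans (energy_outer a1 Hz).
apply: IH => [b bs|]; first by apply: hs; rewrite inE bs orbT.
apply: (eqcoefMI au); rewrite mulrA; apply: eqcoef_trans H _.
rewrite [X in eqcoef _ X]mulrAC [X in eqcoef _ _ X]mulrCA mulrC.
exact/eqcoefM/eqcoef_sym.
Qed.

End Blaschke.

(** * Reversed polynomials *)

Definition revp (A : nzRingType) (p : {poly A}) : {poly A} :=
  \poly_(i < size p) p`_((size p).-1 - i).

Lemma horner_revp (F : fieldType) (p : {poly F}) z : z != 0 ->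
  p.[z] = z ^+ (size p).-1 * (revp p).[z^-1].
Proof.
move=> z0; rewrite horner_coef /revp horner_poly mulr_sumr.
rewrite (reindex_inj rev_ord_inj) /=; apply: eq_bigr => i _.
have iP := ltn_ord i.
have -> : (size p - i.+1 = (size p).-1 - i)%N by lia.
rewrite mulrCA; congr (_ * _); rewrite exprVn exprB ?unitfE//.
  by rewrite -ltnS (ltn_predK iP).
Qed.

Lemma coef_prod_rev (F : fieldType) (s : seq F) i :
  (\prod_(a <- s) (1 - a *: 'X))`_i =
    if (i <= size s)%N then (\prod_(a <- s) ('X - a%:P))`_(size s - i) else 0.
Proof.
elim: s i => [|a s IH] i /=.
  by rewrite !big_nil coef1 leqn0 sub0n coef1; case: eqP.
have sz : size (\prod_(a <- s) ('X - a%:P)) = (size s).+1 by rewrite size_prod_XsubC.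
rewrite !big_cons mulrBl mul1r coefB -scalerAl coefZ coefXM.
rewrite mulrBl coefB coefXM coefCM.
case: i => [|i] /=.
  rewrite mulr0 subr0 subn0 /= IH// subn0.
  by rewrite [X in _ - _ * X]nth_default ?sz// mulr0 subr0.
rewrite subSS !IH ltnS; case: (ltngtP i (size s)) => [lt_is|_|->].
- have -> : ((size s - i)%N == 0%N) = false by lia.
  by congr (_`_ _ - _); lia.
- by rewrite mulr0 subr0.
- by rewrite subnn /= sub0r.
Qed.

Section ReversedPolynomial.
Variable R : rcfType.
Local Notation C := R[i].
Local Notation toC p := (map_poly (intr : int -> C) p).

(** Reversal turns X - a into 1 - a X without conjugating a. The conjugates in [star] are harmless
    because integer coefficients are fixed by conjugation. *)
Lemma revp_int_prod_star (P : {poly int}) (rs : seq C) :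
  P != 0 ->
  toC P = (lead_coef P)%:~R *: \prod_(a <- rs) lin a ->
  forall i, (toC (revp P))`_i = ((lead_coef P)%:~R *: \prod_(a <- rs) star a)`_i.
Proof.
move=> P0 EP i.
have sP : size P = (size rs).+1.
  have <- : size (toC P) = size P by rewrite size_map_inj_poly//; apply: intr_inj.
  by rewrite EP size_scale ?intr_eq0 ?lead_coef_eq0// size_prod_XsubC.
rewrite coef_map /revp coef_poly sP ltnS.
have -> : \prod_(a <- rs) star a = \prod_(a <- map conjc rs) (1 - a *: 'X) by rewrite big_map.
rewrite coefZ coef_prod_rev size_map; case: leqP => _; last by rewrite mulr0.
have -> : \prod_(a <- map conjc rs) ('X - a%:P) = map_poly conjc (\prod_(a <- rs) lin a).
  rewrite rmorph_prod big_map; apply: eq_bigr => a _.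
  by rewrite /lin rmorphB /= map_polyX map_polyC.
rewrite coef_map /=.
have := congr1 (fun q : {poly C} => (q`_(size rs - i))^*) EP.
by rewrite coefZ coef_map rmorphM /= !rmorph_int.
Qed.
End ReversedPolynomial.

(** * Smyth's theorem for integer polynomials *)

Section SmythTheorem.
Variable R : rcfType.
Local Notation C := R[i].
Local Notation toC p := (map_poly (intr : int -> C) p).
Local Notation toR p := (map_poly (intr : int -> R) p).
Local Notation cplx p := (map_poly (real_complex R) p).
Local Notation re p := (map_poly (@complex.Re R) p).
Local Notation normc := (ComplexField.Normc.normc).

Lemma normc_ge0 (z : C) : 0 <= normc z.
Proof. by case: z => a b; apply: sqrtr_ge0. Qed.

Lemma re_mul_cplx (x : {poly R}) (z : {poly C}) : re (cplx x * z) = x * re z.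
Proof.
apply/polyP => n; rewrite coef_map_id0// !coefM raddf_sum /=.
apply: eq_bigr => i _; rewrite coef_map coef_map_id0//=.
by case: z`_(n - i) => a b /=; rewrite mul0r subr0.
Qed.

Lemma energyZ N (u : C) x : energy N (u *: x) = sqmod u * energy N x.
Proof. by rewrite /energy mulr_sumr; apply: eq_bigr => i _; rewrite coefZ sqmodM. Qed.

Lemma energy_cplx N (x : {poly R}) : energy N (cplx x) = \sum_(i < N) x`_i ^+ 2.
Proof. by apply: eq_bigr => i _; rewrite coef_map /sqmod /= expr0n addr0. Qed.

Lemma le_energy_re N (z : {poly C}) : \sum_(i < N) (re z)`_i ^+ 2 <= energy N z.
Proof. by apply: ler_sum => i _; rewrite coef_map_id0// /sqmod lerDl sqr_ge0. Qed.

Lemma toC_cplx h : toC h = cplx (toR h).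
Proof. by apply/polyP => i; rewrite !coef_map /= rmorph_int. Qed.

Lemma prod_normc (s : seq C) (F : C -> C) : 
  normc (\prod_(a <- s) F a) = \prod_(a <- s) normc (F a).
Proof.
elim: s => [|a s IH]; first by rewrite !big_nil ComplexField.Normc.normc1.
by rewrite !big_cons ComplexField.Normc.normcM IH.
Qed.

(** The series u Bs / B contracts energy, and so does its product with h, which is a unimodular
    multiple of A / As. Its real part g inherits both properties: taking real parts commutes with
    multiplication by the real polynomials h and x and does not increase energy. *)
Lemma smyth_reduction N h (s1 s2 : seq C) (kap : C) : (0 < N)%N ->
  {in s1, forall a, sqmod a < 1} -> {in s2, forall a, 1 < sqmod a} ->
  sqmod kap = 1 ->
  eqcoef N (toC h * (\prod_(a <- s1) star a * \prod_(a <- s2) star a))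
    (kap *: (\prod_(a <- s1) lin a * \prod_(a <- s2) lin a)) ->
  exists2 g : {poly R}, g`_0 = (\prod_(a <- s2) normc a)^-1 &
    forall M, (M < N)%N -> hankel_bounded M g /\ hankel_bounded M (toR h * g).
Proof.
move=> N0 hs1 hs2 hk Hh.
set A := \prod_(a <- s1) lin a in Hh; set As := \prod_(a <- s1) star a in Hh.
set B := \prod_(a <- s2) lin a in Hh; set Bs := \prod_(a <- s2) star a in Hh.
set m := \prod_(a <- s2) normc a.
have B0E : B`_0 = \prod_(a <- s2) - a.
  by rewrite coef0_prod; apply: eq_bigr => a _; rewrite lin0.
have mE : normc B`_0 = m.
  rewrite B0E prod_normc; apply: eq_bigr => a _.
  by rewrite -mulN1r ComplexField.Normc.normcM normcN ComplexField.Normc.normc1 mul1r.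
have m0 : 0 < m.
  rewrite /m big_seq; apply: prodr_gt0 => a /hs2.
  rewrite sqmodE => a1; rewrite lt_neqAle normc_ge0 andbT eq_sym.
  by apply: contraTneq a1 => ->; rewrite expr0n ltr10.
have Bu : B`_0 \is a GRing.unit.
  by apply: sqmod_gt0_unit; rewrite sqmodE mE exprn_gt0.
have [iB HiB] := eqcoef_inv N Bu.
(* This unimodular factor makes the constant term of [g1] the positive number 1/m. *)
pose u := B`_0 * (m^-1)%:C.
have u1 : sqmod u = 1.
  by rewrite sqmodM sqmodE mE /sqmod /= expr0n addr0 -exprMn divff ?expr1n// gt_eqF.
pose g1 := u *: (iB * Bs).
have Bg1 : eqcoef N (B * g1) (u *: Bs).
  have BiB : eqcoef N (B * (iB * Bs)) Bs.
    have -> : B * (iB * Bs) = Bs * (B * iB) by ring.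
    by rewrite -[X in eqcoef _ _ X]mulr1; apply: eqcoefM.
  by rewrite /g1 -scalerAr => i iN; rewrite !coefZ BiB.
have g10 : g1`_0 = (m^-1)%:C.
  have Bs0 : Bs`_0 = 1 by rewrite coef0_prod big1// => a _; rewrite star0.
  have : B`_0 * g1`_0 = u * Bs`_0 by rewrite -coef0M -coefZ; exact: Bg1.
  rewrite Bs0 mulr1.
  by rewrite /u => /(mulrI Bu).
exists (re g1) => [|M MN]; first by rewrite coef_map_id0// g10.
have contr x : energy M.+1 (g1 * cplx x) <= energy M.+1 (cplx x) /\
    energy M.+1 (toC h * g1 * cplx x) <= energy M.+1 (cplx x).
  set y := cplx x.
  have Bv : eqcoef M.+1 (B * (g1 * y)) (Bs * (u *: y)).
    have -> : B * (g1 * y) = y * (B * g1) by ring.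
    have -> : Bs * (u *: y) = y * (u *: Bs) by rewrite -!mul_polyC; ring.
    by move=> i iM; apply: (eqcoefM y Bg1); apply: leq_trans MN.
  split; first by rewrite (le_trans (energy_outer_prod hs2 Bv))// energyZ u1 mul1r.
  have Av : eqcoef M.+1 (As * (toC h * g1 * y)) (A * ((kap * u) *: y)).
    apply: (eqcoefMI Bu).
    have -> : B * (As * (toC h * g1 * y)) = (toC h * As) * (B * (g1 * y)) by ring.
    apply: eqcoef_trans (eqcoefM _ Bv) _.
    have -> : toC h * As * (Bs * (u *: y)) = (u *: y) * (toC h * (As * Bs)) by ring.
    have -> : B * (A * ((kap * u) *: y)) = (u *: y) * (kap *: (A * B)).
      by rewrite -!mul_polyC rmorphM /=; ring.
    by apply: eqcoefM => i iM; apply: Hh; apply: leq_trans MN.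
  by rewrite (le_trans (energy_inner_prod hs1 Av))// energyZ sqmodM u1 hk !mul1r.
split; apply: contraction_hankel => x; rewrite -(energy_cplx _ x).
  rewrite mulrC -re_mul_cplx mulrC.
  by apply: le_trans (le_energy_re _ _) _; case: (contr x).
rewrite -re_mul_cplx -toC_cplx mulrC -re_mul_cplx mulrC.
by apply: le_trans (le_energy_re _ _) _; case: (contr x).
Qed.

Theorem smyth (P : {poly int}) (rs : seq C) (lam : R) :
  `|P`_0| = 1 -> `|lead_coef P| = 1 ->
  toC P = (lead_coef P)%:~R *: \prod_(a <- rs) lin a ->
  ~ (exists2 e : C, e = 1 \/ e = -1 & forall z : C, z != 0 ->
      (toC P).[z] = e * z ^+ (size (toC P)).-1 * (toC P).[z^-1]) ->
  lam ^+ 3 - lam - 1 = 0 ->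
  lam <= \prod_(a <- rs) Num.max 1 (normc a).
Proof.
move=> P0 Pl EP nrec lamE.
have Pn0 : P != 0 by rewrite -lead_coef_eq0; apply: contra_eqN Pl => /eqP ->; rewrite normr0.
pose eps := lead_coef P * P`_0.
have pm1 (z : int) : `|z| = 1 -> z = 1 \/ z = -1 by lia.
have sq1 (z : int) : `|z| = 1 -> z * z = 1.
  by move=> /pm1[] ->; rewrite ?mulr1// mulrNN mulr1.
have epseps : eps * eps = 1 by rewrite /eps mulrACA !sq1.
pose n := (size P).-1.
have sP : size P = n.+1 by rewrite prednK// size_poly_gt0.
have rev0 : (revp P)`_0 = lead_coef P.
  by rewrite coef_poly lt0n size_poly_eq0 Pn0 subn0 lead_coefE.
have revu : (revp P)`_0 \is a GRing.unit.
  by rewrite rev0; case: (pm1 _ Pl) => ->; rewrite ?unitrN unitr1.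
(* Coefficients up to 2k are needed, where k is at most the degree n. *)
pose N := (n + n).+1.
(* The constant term of [revp P] is the leading coefficient of P, a unit of the integers, so the
   quotient h has integer coefficients; [eps] normalises its constant term to 1. *)
have [s Hs] := eqcoef_inv N revu.
pose h := eps *: (s * P).
have hrev : eqcoef N (h * revp P) (eps *: P).
  move=> i iN; rewrite /h -scalerAl !coefZ; congr (_ * _).
  have -> : s * P * revp P = P * (revp P * s) by ring.
  by rewrite -[in RHS](mulr1 P); apply: (eqcoefM _ Hs).
have h0 : h`_0 = 1.
  have : h`_0 * lead_coef P = eps * P`_0 by rewrite -rev0 -coef0M hrev// coefZ.
  rewrite /eps -mulrA sq1// mulr1 => /(congr1 (fun z => z * lead_coef P)).
  by rewrite -mulrA sq1// mulr1.
have toC_rev : revp (toC P) = toC (revp P).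
  have sC : size (toC P) = size P by rewrite size_map_inj_poly//; apply: intr_inj.
  apply/polyP => i; rewrite coef_map [in LHS]/revp coef_poly sC coef_map [in RHS]/revp coef_poly /=.
  by case: ltnP.
have [k [k0 kn hk hlow]] : exists k, [/\ (0 < k)%N, (k <= n)%N, h`_k != 0 &
    forall i, (0 < i < k)%N -> h`_i = 0].
  have [/hasP[k kr hk]|/hasPn nk] := boolP (has (fun k => h`_k != 0) (iota 1 n)).
    have ex : exists k, (0 < k)%N && (h`_k != 0).
      by exists k; rewrite hk andbT; move: kr; rewrite mem_iota => /andP[].
    case: (ex_minnP ex) => k1 /andP[k10 hk1] kmin; exists k1; split => //.
      have := kmin k; rewrite hk andbT; move: kr; rewrite mem_iota; clear; lia.
    move=> i /andP[i0 ik]; apply/eqP; apply: contraTT ik => hi.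
    by rewrite -leqNgt kmin// i0 hi.
  (* Otherwise h is 1 modulo X^(n+1), hence [revp P] equals [eps *: P] and P is reciprocal. *)
  have {}nk i : (0 < i <= n)%N -> h`_i = 0.
    by move=> ?; apply/eqP; have := nk i; rewrite mem_iota negbK; apply; lia.
  exfalso; apply: nrec.
  have revE : revp P = eps *: P.
    apply/polyP => i; have [si|iN] := leqP (size P) i.
      by rewrite coefZ [P`_i]nth_default// mulr0 coef_poly ltnNge si.
    rewrite -hrev; last by move: iN; rewrite sP /N; clear; lia.
    rewrite coefM big_ord_recl h0 mul1r subn0 big1 ?addr0// => j _.
    rewrite nk ?mul0r//= /bump leq0n add1n; have := ltn_ord j.
    by move: iN; rewrite sP; clear; lia.
  exists (eps%:~R).
    by rewrite /eps; case: (pm1 _ P0) => ->; case: (pm1 _ Pl) => ->; [left|right|right|left];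
      rewrite /= ?mulr1 ?mulrN1 ?opprK ?rmorphN1 ?rmorph1.
  move=> z z0; rewrite horner_revp// toC_rev revE map_polyZ hornerZ.
  by rewrite mulrCA mulrA.
pose s1 := [seq a <- rs | sqmod a < 1].
pose s2 := [seq a <- rs | 1 < sqmod a].
pose s0 := [seq a <- rs | sqmod a == 1].
have split3 (F : C -> {poly C}) : \prod_(a <- rs) F a =
    \prod_(a <- s0) F a * (\prod_(a <- s1) F a * \prod_(a <- s2) F a).
  rewrite !big_filter; elim: (rs) => [|a t IH]; first by rewrite !big_nil !mulr1.
  by rewrite !big_cons IH; case: ltrgtP => _; ring.
(* For |a| = 1 one has lin a = - a star a, so the zeros on the circle cancel in the quotient up to a
   unimodular constant. *)
have [kap kap1 Hkap] : exists2 kap : C, sqmod kap = 1 &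
    \prod_(a <- s0) lin a = kap *: \prod_(a <- s0) star a.
  rewrite !big_filter; elim: (rs) => [|a t [kap kap1 IH]].
    by exists 1; rewrite ?big_nil ?scale1r// /sqmod /= expr1n expr0n addr0.
  rewrite !big_cons; case: eqP => [a1|_]; last by exists kap.
  exists (- a * kap).
    by rewrite sqmodM kap1 mulr1 -a1; case: (a) => ? ?; rewrite /sqmod /= !sqrrN.
  rewrite IH.
  have -> : lin a = - a *: star a.
    by rewrite /lin /star scalerBr scalerA mulNr conjc_mul_self a1 scaleN1r opprK
         addrC -mul_polyC mulr1 polyCN.
  by rewrite -scalerAr -scalerAl scalerA mulrC.
have Hh : eqcoef N (toC h * (\prod_(a <- s1) star a * \prod_(a <- s2) star a))
    ((eps%:~R * kap) *: (\prod_(a <- s1) lin a * \prod_(a <- s2) lin a)).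
  pose q := (lead_coef P)%:~R *: \prod_(a <- s0) star a.
  have qu : q`_0 \is a GRing.unit.
    rewrite coefZ coef0_prod big1 ?mulr1; last by move=> a _; rewrite star0.
    by case: (pm1 _ Pl) => ->; rewrite ?rmorphN1 ?unitrN ?rmorph1 unitr1.
  apply: (eqcoefMI qu).
  have -> : q * (toC h * (\prod_(a <- s1) star a * \prod_(a <- s2) star a)) =
      toC (h * revp P).
    rewrite rmorphM /=; have -> : toC (revp P) = (lead_coef P)%:~R *: \prod_(a <- rs) star a.
      by apply/polyP; apply: revp_int_prod_star.
    by rewrite split3 /q -!mul_polyC; ring.
  have -> : q * ((eps%:~R * kap) *: (\prod_(a <- s1) lin a * \prod_(a <- s2) lin a)) =
      toC (eps *: P).
    rewrite map_polyZ EP split3 Hkap /q -!mul_polyC rmorphM /=; ring.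
  by move=> i iN; rewrite !coef_map /= hrev.
have mE : \prod_(a <- s2) normc a = \prod_(a <- rs) Num.max 1 (normc a).
  rewrite big_filter big_mkcond; apply: eq_bigr => a _.
  by rewrite sqmodE -[X in X < _](expr1n _ 2) ltr_pXn2r ?nnegrE ?normc_ge0//.
have := @smyth_reduction N h s1 s2 (eps%:~R * kap) isT.
case.
- by move=> a; rewrite mem_filter => /andP[].
- by move=> a; rewrite mem_filter => /andP[].
- rewrite sqmodM kap1 mulr1; case: (pm1 eps) => [|->|->]; last 2 first.
  + by rewrite /sqmod /= expr1n expr0n addr0.
  + by rewrite rmorphN1 /sqmod /= sqrrN oppr0 expr1n expr0n addr0.
  by rewrite /eps normrM P0 Pl.
- exact: Hh.
move=> g g0 gH; rewrite mE in g0; set M := \prod_(a <- rs) _ in g0 *.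
have M1 : 1 <= M.
  rewrite /M; elim: (rs) => [|a t IH]; first by rewrite big_nil.
  by rewrite big_cons mulr_ege1 ?le_max ?lexx.
have M0 : 0 < M by apply: lt_le_trans M1.
have := @smyth_core R g h k k0 h0 hk hlow.
rewrite g0 invr_gt0 => /(_ M0) H.
have {}H : M^-1 ^+ 3 + M^-1 ^+ 2 <= 1.
  by apply: H => N' N'k; case: (gH N') => //; rewrite /N; move: N'k kn; clear; lia.
have {}H : 1 + M <= M ^+ 3.
  rewrite -(ler_pM2r (_ : 0 < M ^+ 3)) ?exprn_gt0// mul1r in H.
  by apply: le_trans H; rewrite le_eqVlt; apply/orP; left; apply/eqP; field; rewrite gt_eqF.
rewrite leNgt; apply/negP => Ml.
(* This is the increase of t^3 - t from M to lam, which cannot be positive as t^3 - t is at least 1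
   at M and equals 1 at lam. *)
have : 0 < (lam - M) * (lam ^+ 2 + lam * M + M ^+ 2 - 1).
  rewrite mulr_gt0 ?subr_gt0//.
  have : 1 < lam by apply: le_lt_trans Ml.
  by move: M1; clear; nra.
have -> : (lam - M) * (lam ^+ 2 + lam * M + M ^+ 2 - 1) =
  lam ^+ 3 - lam - M ^+ 3 + M by ring.
by move: H lamE; clear; lra.
Qed.
End SmythTheorem.

(** * Trigonometric polynomials and almost sure boundedness *)

Section AE.
Variable R : realType.
Local Notation mu := (@lebesgue_measure R).
Lemma ae_imp (P Q : R -> Prop) : (forall x, P x -> Q x) ->
  {ae mu, forall x, P x} -> {ae mu, forall x, Q x}.
Proof.
move=> PQ. apply: negligibleS => x /= nQ Px. by apply: nQ; apply: PQ.
Qed.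
Lemma ae_and (P Q : R -> Prop) : {ae mu, forall x, P x} -> {ae mu, forall x, Q x} -> 
  {ae mu, forall x, P x /\ Q x}.
Proof.
move=> p q; have := negligibleU p q; apply: negligibleS => x /= nPQ.
by apply: contrapT => /not_orP[/contrapT Px /contrapT Qx]; apply: nPQ.
Qed.
End AE.

(** * Mean values of periodic functions *)

Section MeanValue.
Variable R : realType.
Implicit Types (V : R -> R) (b : R).

(* An antiderivative with F (x + 1) = F x + b expresses that V has mean b over
   every interval of length one, without integrals. *)
Definition has_mean V b := continuous V /\
  exists F : R -> R, (forall x : R, is_derive x (1 : R) F (V x)) /\
    forall x, F (x + 1) = F x + b.

Lemma is_derive_linear (c x : R) : is_derive x (1 : R) (fun y : R => c * y) c.
Proof.
by apply: is_derive_eq; rewrite /GRing.scale /= mulr1.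
Qed.

Lemma periodic_int (f : R -> R) (T u : R) (k : int) :
  periodic f T -> f (u + T * k%:~R) = f u.
Proof.
move=> pf; case: k => n.
  by rewrite -[n%:~R]/(n%:R) mulr_natr periodicn.
by rewrite NegzE mulrNz mulrN -[in RHS](subrK (T * n.+1%:R) u) mulr_natr periodicn.
Qed.

Lemma has_mean_const c : has_mean (fun=> c) c.
Proof.
split; first by move=> x; apply: cvg_cst.
exists (fun x => c * x); split => [x|x]; last by rewrite mulrDr mulr1.
exact: is_derive_linear.
Qed.

Lemma has_meanD V W b c : has_mean V b -> has_mean W c ->
  has_mean (fun x => V x + W x) (b + c).
Proof.
move=> [cV [F [dF FE]]] [cW [G [dG GE]]]; split.
  by move=> x; apply: cvgD; [exact: cV|exact: cW].
exists (fun x => F x + G x); split => x; first exact: is_deriveD.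
by rewrite FE GE addrACA.
Qed.

Lemma has_meanZ k V b : has_mean V b -> has_mean (fun x => k * V x) (k * b).
Proof.
move=> [cV [F [dF FE]]]; split; first by move=> x; apply: cvgMr; exact: cV.
exists (fun x => k * F x); split => x; first exact: is_deriveZ.
by rewrite FE mulrDr.
Qed.

Lemma has_mean_sum (I : Type) (r : seq I) (P : pred I) (V : I -> R -> R) (b : I -> R) :
  (forall i, P i -> has_mean (V i) (b i)) ->
  has_mean (fun x => \sum_(i <- r | P i) V i x) (\sum_(i <- r | P i) b i).
Proof.
move=> H; elim: r => [|i r IH].
  rewrite big_nil (_ : (fun x => _) = fun=> 0); first exact: has_mean_const.
  by apply/funext => x; rewrite big_nil.
rewrite big_cons (_ : (fun x => _) =
   if P i then fun x => V i x + \sum_(j <- r | P j) V j x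
   else fun x => \sum_(j <- r | P j) V j x).
  by case: ifP => // Pi; apply: has_meanD => //; apply: H.
by apply/funext => x; rewrite big_cons; case: ifP.
Qed.

Lemma has_mean_trig (A B : R) (k : int) : k != 0 ->
  has_mean (fun x => A * cos (2 * pi * k%:~R * x) + B * sin (2 * pi * k%:~R * x)) 0.
Proof.
move=> k0; set w := 2 * pi * k%:~R.
have w0 : w != 0.
  by rewrite /w !mulf_eq0 !negb_or intr_eq0 k0 pnatr_eq0 andbT/= gt_eqF ?pi_gt0.
have dl := is_derive_linear w.
split.
  move=> x; apply: cvgD; apply: cvgMr.
    apply: (cvg_comp (fun y => w * y) (fun y => cos y)); last exact: continuous_cos.
    by apply: cvgMr; exact: cvg_id.
  apply: (cvg_comp (fun y => w * y) (fun y => sin y)); last exact: continuous_sin.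
  by apply: cvgMr; exact: cvg_id.
exists (fun x => (A / w) * sin (w * x) + (- B / w) * cos (w * x)); split => x.
  have ds : is_derive x (1 : R) (fun y : R => sin (w * y)) (cos (w * x) * w).
    exact: (@is_derive1_comp _ sin (fun y => w * y)).
  have dc : is_derive x (1 : R) (fun y : R => cos (w * y)) (- sin (w * x) * w).
    exact: (@is_derive1_comp _ cos (fun y => w * y)).
  apply: (is_derive_eq (is_deriveD (is_deriveZ (A / w) ds) (is_deriveZ (- B / w) dc))).
  by rewrite /GRing.scale /=; field.
have E2 : w * (x + 1) = w * x + (pi *+ 2) * k%:~R.
  by rewrite mulrDr mulr1 {2}/w [2 * pi]mulr_natl.
by rewrite addr0 E2 !periodic_int//; [exact: cosD2pi|exact: sinD2pi].
Qed.

End MeanValue.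

Section TrigPolynomials.
Variable R : realType.
Local Notation C := R[i].
Local Notation normc := (ComplexField.Normc.normc).
Implicit Types (x y : R) (z : C).

Lemma expi2piD x y : expi2pi (x + y) = expi2pi x * expi2pi y :> C.
Proof.
rewrite /expi2pi mulrDr cosD sinD; apply/eqP; rewrite eq_complex /=.
by rewrite eqxx /= addrC.
Qed.

Lemma expi2pi0 : expi2pi 0 = 1 :> C.
Proof. by rewrite /expi2pi mulr0 cos0 sin0. Qed.

Lemma expi2piX x n : expi2pi (x * n%:R) = expi2pi x ^+ n :> C.
Proof.
elim: n => [|n IH]; first by rewrite mulr0 expi2pi0.
by rewrite -natr1 mulrDr mulr1 expi2piD IH exprSr.
Qed.

Lemma normc_expi2pi x : normc (expi2pi x) = 1.
Proof. by rewrite /= cos2Dsin2 sqrtr1. Qed.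

Lemma sqmod_sum (I : finType) (F : I -> C) :
  sqmod (\sum_i F i) = \sum_i \sum_j complex.Re (F i * (F j)^*).
Proof.
have -> : sqmod (\sum_i F i) = complex.Re ((\sum_i F i) * (\sum_i F i)^*).
  by rewrite conjc_mul_self.
rewrite raddf_sum mulr_suml raddf_sum; apply: eq_bigr => i _ /=.
by rewrite mulr_sumr raddf_sum.
Qed.

Lemma Re_trig_pair (c d : C) (p q : nat) x :
  complex.Re ((c * expi2pi x ^+ p) * (d * expi2pi x ^+ q)^*) =
  complex.Re (c * d^*) * cos (2 * pi * (p%:Z - q%:Z)%:~R * x) +
  - complex.Im (c * d^*) * sin (2 * pi * (p%:Z - q%:Z)%:~R * x).
Proof.
rewrite -!expi2piX /expi2pi.
have -> : 2 * pi * (p%:Z - q%:Z)%:~R * x = 2 * pi * (x * p%:R) - 2 * pi * (x * q%:R).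
  by rewrite rmorphB /=; ring.
rewrite cosB sinB; case: c d => [a b] [a' b'] /=; ring.
Qed.

Lemma Re_mul_conj_le (c d : C) : complex.Re (c * d^*) <= normc c * normc d.
Proof.
case: c d => [a b] [a' b'] /=; rewrite -sqrtrM ?addr_ge0 ?sqr_ge0//.
apply: le_trans (ler_norm _) _; rewrite -sqrtr_sqr; apply: ler_wsqrtr.
by have := sqr_ge0 (a * b' - b * a'); lra.
Qed.

(* Orthogonality of the characters: only pairs of equal frequencies contribute. *)
Lemma has_mean_trig_poly (I : finType) (c : I -> C) (q : I -> nat) :
  exists2 b : R, has_mean (fun x => sqmod (\sum_i c i * expi2pi x ^+ q i)) b &
    b <= \sum_i \sum_j (q i == q j)%:R * (normc (c i) * normc (c j)).
Proof.
exists (\sum_i \sum_j (q i == q j)%:R * complex.Re (c i * (c j)^*)).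
  rewrite (_ : (fun x => _) = (fun x => \sum_i \sum_j
     complex.Re ((c i * expi2pi x ^+ q i) * (c j * expi2pi x ^+ q j)^*))); last first.
    by apply/funext => x; rewrite sqmod_sum.
  apply: has_mean_sum => i _; apply: has_mean_sum => j _.
  have [Eq|nq] := eqVneq (q i) (q j).
    rewrite (_ : (fun x => _) = fun=> complex.Re (c i * (c j)^*)).
      by rewrite mul1r; apply: has_mean_const.
    by apply/funext => x; rewrite Re_trig_pair Eq subrr mulr0 mul0r cos0 sin0 mulr0 addr0 mulr1.
  rewrite mul0r (_ : (fun x => _) = (fun x =>
    complex.Re (c i * (c j)^*) * cos (2 * pi * ((q i)%:Z - (q j)%:Z)%:~R * x) +
    - complex.Im (c i * (c j)^*) * sin (2 * pi * ((q i)%:Z - (q j)%:Z)%:~R * x))).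
    by apply: has_mean_trig; rewrite subr_eq0 eqz_nat.
  by apply/funext => x; rewrite Re_trig_pair.
apply: ler_sum => i _; apply: ler_sum => j _.
by rewrite ler_wpM2l// Re_mul_conj_le.
Qed.

End TrigPolynomials.

(** * From bounded means to almost sure bounds *)

Section MeanIntegral.
Variable R : realType.
Local Notation mu := (@lebesgue_measure R).
Implicit Types (V : R -> R) (b : R).

Lemma has_mean_integral V b a : has_mean V b ->
  (\int[mu]_(x in `[a, (a + 1)%R]) (V x)%:E)%E = b%:E.
Proof.
move=> [cV [F [dF FE]]].
have cF : continuous F.
  move=> x; apply: differentiable_continuous; apply/derivable1_diffP.
  by have := dF x => -[].
rewrite (@continuous_FTC2 _ _ F); first by rewrite FE -EFinB addrAC subrr add0r.
- by rewrite ltrDl.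
- exact: continuous_subspaceT.
- split.
  + by move=> x _; have := dF x => -[].
  + by apply: cvg_at_right_filter; exact: cF.
  + by apply: cvg_at_left_filter; exact: cF.
- by move=> x _; rewrite derive1E; have := dF x => -[].
Qed.

Lemma ae_unit_intervals (P : R -> Prop) :
  (forall a, {ae mu, forall x, x \in `[a, a + 1] -> P x}) -> {ae mu, forall x, P x}.
Proof.
move=> H.
have H1 := ae_foralln (fun n : nat => H (n%:R)).
have H2 := ae_foralln (fun n : nat => H (- (n.+1)%:R)).
apply: filterS2 H1 H2 => x h1 h2.
have /andP[f1 f2] := floor_itv x.
case E : (Num.floor x) f1 f2 => [n|n] f1 f2.
  by apply: (h1 n); rewrite in_itv /= f1 /= ltW//; move: f2; rewrite rmorphD.
by apply: (h2 n); rewrite in_itv /=; move: f1 f2; rewrite NegzE rmorphD /= mulrNz => -> /ltW.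
Qed.

Lemma has_mean_fatou (V : nat -> R -> R) (b : nat -> R) (B a : R) :
  (forall N, has_mean (V N) (b N)) -> (forall N, b N <= B) ->
  (forall N x, 0 <= V N x) ->
  let g (x : R) := limn_einf (fun N => (V N x)%:E) in
  [/\ measurable_fun (`[a, a + 1]%classic : set R) g, (forall x, (0 <= g x)%E) &
      (\int[mu]_(x in `[a, (a + 1)%R]) g x <= B%:E)%E].
Proof.
move=> HV bB V0 /=; set D := `[a, a + 1]%classic.
have mD : measurable D by exact: measurable_itv.
pose f N : R -> \bar R := fun x => (V N x)%:E.
have mV N : measurable_fun D (f N).
  apply/measurable_EFinP; apply: measurable_funTS; apply: continuous_measurable_fun.
  by have [] := HV N.
have f0 N x : D x -> (0 <= f N x)%E by move=> _; rewrite lee_fin.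
split.
- rewrite (_ : (fun x => _) = fun x => (- limn_esup (fun n => - f n x))%E) //.
  apply: measurableT_comp => //; apply: measurable_fun_limn_esup => n.
  by apply: measurableT_comp => //; exact: mV.
- move=> x; rewrite limn_einf_lim; apply: lime_ge; first exact: is_cvg_einfs.
  by apply: nearW => n; apply: le_ereal_inf_tmp => _ [m /= _ <-]; rewrite lee_fin.
- apply: le_trans (fatou mu mD mV f0) _.
  rewrite limn_einf_lim; apply: lime_le; first exact: is_cvg_einfs.
  apply: nearW => n; apply: le_trans (ereal_inf_lbound _) _.
    by exists n => //=; rewrite leqnn.
  by rewrite (has_mean_integral _ (HV n)) lee_fin.
Qed.

(** By Fatou's lemma the lower limit of V N has integral at most B over each unit interval, so it is
    finite almost everywhere. Where every bound M is eventually exceeded, it is infinite. *)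
Lemma ae_bounded_subsequence (V : nat -> R -> R) (b : nat -> R) (B : R) :
  (forall N, has_mean (V N) (b N)) -> (forall N, b N <= B) ->
  (forall N x, 0 <= V N x) ->
  {ae mu, forall x, exists M : R, forall N0, exists2 N, (N0 <= N)%N & V N x <= M}.
Proof.
move=> HV bB V0; apply: ae_unit_intervals => a.
pose L : R -> \bar R := fun x => limn_einf (fun N => (V N x)%:E).
have [mL L0 LB] := has_mean_fatou a HV bB V0.
have iL : mu.-integrable (`[a, a + 1]%classic : set R) L.
  apply/integrableP; split; first exact: mL.
  under eq_integral => x _ do rewrite (gee0_abs (L0 x)).
  by apply: le_lt_trans LB _; rewrite ltry.
have := @integrable_ae _ _ _ mu _ (measurable_itv _) L iL; apply: ae_imp => x Hx xD.
have {Hx} := Hx xD => Lfin; apply: contrapT => nM.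
have : L x = +oo%E.
  apply: (cvg_limn_einf_sup _).1; apply/cvgeryP/cvgryPge => A.
  apply: contrapT => nA; apply: nM; exists A => N0.
  apply: contrapT => nN; apply: nA; exists N0 => // N /= N0N.
  by rewrite leNgt; apply/negP => VA; apply: nN; exists N => //; exact: ltW.
by move=> E; rewrite E in Lfin.
Qed.
End MeanIntegral.

(** * The strong law for ln |1 - beta e(L^j x)| *)

Section LogSeries.
Variable R : realType.
Local Notation C := R[i].
Local Notation normc := (ComplexField.Normc.normc).

Lemma is_derive_bigsum n (h : 'I_n -> R -> R) (dh : 'I_n -> R) (x : R) :
  (forall i, is_derive x (1 : R) (h i) (dh i)) ->
  is_derive x (1 : R) (fun y => \sum_(i < n) h i y) (\sum_(i < n) dh i).
Proof.
elim: n h dh => [|n IH] h dh H.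
  rewrite big_ord0 (_ : (fun _ => _) = cst 0); first exact: is_derive_cst.
  by apply/funext => y; rewrite big_ord0.
rewrite big_ord_recr (_ : (fun _ => _) = (fun y =>
   \sum_(i < n) h (widen_ord (leqnSn n) i) y + h ord_max y)).
  by apply: is_deriveD => //; apply: IH.
by apply/funext => y; rewrite big_ord_recr.
Qed.

Lemma is_derive_monomial (c : R) n (x : R) :
  is_derive x (1 : R) (fun y => c * y ^+ n.+1) (c * (n.+1%:R * x ^+ n)).
Proof.
have H : is_derive x (1 : R) (fun y : R => y ^+ n.+1) (n.+1%:R * x ^+ n).
  rewrite (_ : (fun y : R => y ^+ n.+1) = (id : R -> R) ^+ n.+1); last first.
    by apply/funext => y; rewrite exprfctE.
  by apply: is_derive_eq; rewrite /GRing.scale /= mulr1.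
exact: (is_deriveZ c H).
Qed.

Lemma normcX (z : C) n : normc (z ^+ n) = normc z ^+ n.
Proof.
elim: n => [|n IH]; first exact: ComplexField.Normc.normc1.
by rewrite !exprS ComplexField.Normc.normcM IH.
Qed.

Lemma normc_real (r : R) : normc (r%:C : C) = `|r|.
Proof. by rewrite /= expr0n addr0 sqrtr_sqr. Qed.

Lemma Re_le_normc (z : C) : `|complex.Re z| <= normc z.
Proof.
case: z => a b /=; rewrite -sqrtr_sqr; apply: ler_wsqrtr.
by rewrite lerDl sqr_ge0.
Qed.

(** Both |1 - w| <= |1 - r w| + (1 - r) and 1 - r <= |1 - r w| are triangle inequalities. The result
    keeps the segment from 0 to w away from 1, uniformly in r. *)
Lemma normc_sub_ray (w : C) (r : R) : normc w <= 1 -> 0 <= r <= 1 ->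
  normc (1 - w) <= 2 * normc (1 - r%:C * w).
Proof.
move=> w1 /andP[r0 r1].
have h1 : normc (1 - w) <= normc (1 - r%:C * w) + (1 - r).
  have -> : 1 - w = (1 - r%:C * w) + (- (1 - r)%:C * w).
    by rewrite rmorphB /= rmorph1; ring.
  apply: le_trans (le_normcD _ _) _; rewrite lerD2l.
  rewrite ComplexField.Normc.normcM normcN.
  have -> : normc ((1 - r)%:C : C) = 1 - r.
    by rewrite /= expr0n addr0 sqrtr_sqr ger0_norm// subr_ge0.
  by rewrite ler_piMr// subr_ge0.
have h2 : 1 - r <= normc (1 - r%:C * w).
  have : 1 <= normc (1 - r%:C * w) + r.
    rewrite -[1 in X in X <= _](ComplexField.Normc.normc1 R).
    have {1}-> : (1 : C) = (1 - r%:C * w) + r%:C * w by rewrite subrK.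
    apply: le_trans (le_normcD _ _) _; rewrite lerD2l ComplexField.Normc.normcM.
    have -> : normc (r%:C : C) = r by rewrite /= expr0n addr0 sqrtr_sqr ger0_norm.
    by rewrite ler_piMr.
  lra.
lra.
Qed.

(* Differentiate in r the same expression for r w: what is left of the
   geometric series after N terms is -w (r w)^N / (1 - r w). *)
Lemma log_series_bound (w : C) N : normc w <= 1 -> w != 1 ->
  `|ln (normc (1 - w)) + \sum_(n < N) complex.Re (w ^+ n.+1) / n.+1%:R|
    <= 2 / normc (1 - w) / N.+1%:R.
Proof.
move=> w1 wn1.
have eta0 : 0 < normc (1 - w).
  rewrite lt_neqAle normc_ge0 andbT eq_sym; apply: contraNneq wn1.
  by move=> /ComplexField.Normc.eq0_normc /eqP; rewrite subr_eq0 eq_sym.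
set eta := normc (1 - w) in eta0 *.
have ray0 (r : R) : 0 <= r <= 1 -> 0 < normc (1 - r%:C * w).
  by move=> r01; have := normc_sub_ray w1 r01; rewrite -/eta; lra.
pose a := complex.Re w; pose b := complex.Im w.
pose q (r : R) := (1 - r * a) ^+ 2 + (r * b) ^+ 2.
have qE r : q r = sqmod (1 - r%:C * w).
  by rewrite /q /a /b; case: (w) => u v; rewrite /sqmod /=; ring.
have q0 r : 0 <= r <= 1 -> 0 < q r.
  by move=> r01; rewrite qE sqmodE exprn_gt0// ray0.
pose phi (r : R) := 2^-1 * ln (q r) +
  \sum_(n < N) (complex.Re (w ^+ n.+1) / n.+1%:R) * r ^+ n.+1.
pose dphi (r : R) := 2^-1 * ((q r)^-1 * (2 * (1 - r * a) * - a + 2 * (r * b) * b)) +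
  \sum_(n < N) (complex.Re (w ^+ n.+1) / n.+1%:R) * (n.+1%:R * r ^+ n).
have Dphi (r : R) : 0 <= r <= 1 -> is_derive r (1 : R) phi (dphi r).
  move=> r01; apply: is_deriveD; last first.
    by apply: is_derive_bigsum => i; apply: is_derive_monomial.
  apply: is_deriveZ; apply: (@is_derive1_comp _ (@ln R) q).
    exact/is_derive1_ln/q0.
  rewrite (_ : q = (fun y => 1 + (- (2 * a) * y + (a ^+ 2 + b ^+ 2) * y ^+ 2))); last first.
    by apply/funext => y; rewrite /q; ring.
  apply: (is_derive_eq (is_deriveD (is_derive_cst (1 : R) r 1)
    (is_deriveD (is_derive_linear _ r) (is_derive_monomial _ 1 r)))).
  by ring.
have dphi_bound r : 0 <= r <= 1 -> `|dphi r| <= 2 / eta * r ^+ N.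
  move=> r01; set D := 1 - r%:C * w.
  have D0 : D != 0.
    apply: contraTneq (ray0 _ r01) => E; rewrite -/D E ComplexField.Normc.normc0.
    by rewrite ltxx.
  pose Z := - w / D + w * \sum_(n < N) (r%:C * w) ^+ n.
  have ZE : Z = - (w * (r%:C * w) ^+ N) / D.
    have H : (1 - r%:C * w) * \sum_(n < N) (r%:C * w) ^+ n = 1 - (r%:C * w) ^+ N.
      by rewrite -opprB mulNr -subrX1 opprB.
    rewrite /Z; have -> : \sum_(n < N) (r%:C * w) ^+ n = (1 - (r%:C * w) ^+ N) / D.
      by rewrite -H -/D mulrAC divff ?mul1r.
    by field.
  have dphiE : dphi r = complex.Re Z.
    rewrite /Z raddfD /=; congr (_ + _).
      have -> : D^-1 = ((q r)^-1)%:C * D^*.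
        apply: (mulfI D0); rewrite divff// mulrCA conjc_mul_self -qE -rmorphM /=.
        by rewrite mulVf ?rmorph1// gt_eqF// q0.
      by rewrite /D /a /b; case: (w) (q r) => u v Q /=; move: Q^-1 => Q'; field.
    rewrite mulr_sumr raddf_sum; apply: eq_bigr => n _ /=.
    have -> : w * (r%:C * w) ^+ n = (r ^+ n)%:C * w ^+ n.+1.
      by rewrite rmorphXn exprMn exprS; ring.
    case: (w ^+ n.+1) => u v /=; rewrite mul0r subr0; field.
    by rewrite nat1r pnatr_eq0.
  rewrite dphiE; apply: le_trans (Re_le_normc _) _; rewrite ZE.
  have /andP[r0 r1] := r01.
  rewrite ComplexField.Normc.normcM normcN ComplexField.Normc.normcM normcX.
  rewrite ComplexField.Normc.normcM ComplexField.Normc.normcV normc_real ger0_norm//.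
  have h : eta <= 2 * normc D by apply: normc_sub_ray.
  have hV : (normc D)^-1 <= 2 / eta.
    by rewrite -div1r ler_pdivrMr ?ray0// mulrAC ler_pdivlMr// mul1r.
  rewrite mulrC ler_pM ?invr_ge0 ?mulr_ge0 ?exprn_ge0 ?mulr_ge0 ?normc_ge0//.
  rewrite exprMn mulrCA ler_piMr ?exprn_ge0// mulr_ile1 ?exprn_ge0 ?normc_ge0//.
  by rewrite exprn_ile1 ?normc_ge0.
(* Instead of integrating the bound on [dphi], its antiderivative plus or minus [phi] is shown to be
   non-decreasing on [0, 1]; it vanishes at 0. *)
have mono (s : R) : `|s| = 1 -> 0 <= 2 / eta / N.+1%:R + s * phi 1.
  move=> s1; pose psi (r : R) := (2 / eta / N.+1%:R) * r ^+ N.+1 + s * phi r.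
  have Dpsi (r : R) : 0 <= r <= 1 -> is_derive r (1 : R) psi
      ((2 / eta / N.+1%:R) * (N.+1%:R * r ^+ N) + s * dphi r).
    by move=> /Dphi H; exact: (is_deriveD (is_derive_monomial _ N r) (is_deriveZ s H)).
  have : psi 0 <= psi 1.
    apply: (@ger0_derive1_ndecr _ psi 0 1) (lexx _) ler01 (lexx _).
    - by move=> x; rewrite in_itv /= => /andP[/ltW x0 /ltW x1]; have [] := Dpsi x; rewrite ?x0.
    - move=> x; rewrite in_itv /= => /andP[/ltW x0 /ltW x1].
      have x01 : 0 <= x <= 1 by rewrite x0.
      rewrite derive1E; have [_ ->] := Dpsi x x01.
      have := dphi_bound x x01; rewrite ler_norml => /andP[h1 h2].
      have -> : 2 / eta / N.+1%:R * (N.+1%:R * x ^+ N) = 2 / eta * x ^+ N.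
        by field; rewrite nat1r pnatr_eq0 gt_eqF.
      have : s = 1 \/ s = -1.
        by move/eqP: s1; rewrite eqr_norml => /andP[/orP[]/eqP]; [left|right].
      by case=> ->; lra.
    - apply: derivable_within_continuous => x; rewrite in_itv /= => x01.
      by have [] := Dpsi x x01.
  rewrite /psi expr1n mulr1 expr0n mulr0 add0r.
  have -> : phi 0 = 0.
    rewrite /phi /q !mul0r subr0 expr1n expr0n addr0 ln1 mulr0 add0r.
    by apply: big1 => n _; rewrite expr0n mulr0.
  by rewrite mulr0.
have phi1 : phi 1 = ln eta + \sum_(n < N) complex.Re (w ^+ n.+1) / n.+1%:R.
  rewrite /phi qE mul1r sqmodE lnXn// -/eta; congr (_ + _).
    by rewrite -[ln eta *+ 2]mulr_natl mulKf ?pnatr_eq0.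
  by apply: eq_bigr => n _; rewrite expr1n mulr1.
rewrite -phi1 ler_norml -subr_ge0 opprK addrC -[X in _ && X]subr_ge0.
have := mono (-1) (normrN1 _); have := mono 1 (normr1 _).
by rewrite mul1r mulN1r => -> ->.
Qed.
End LogSeries.

(** * Counting coincidences of frequencies *)

Section FrequencySums.
Variable R : realType.

Lemma sum_inv_sqr_tail (M N : nat) :
  \sum_(m < N) ((M + m).+2%:R^-1) ^+ 2 <= M.+1%:R^-1 - (M + N).+1%:R^-1 :> R.
Proof.
elim: N => [|N IH]; first by rewrite big_ord0 addn0 subrr.
rewrite big_ord_recr /= addnS.
suff : ((M + N).+2%:R^-1) ^+ 2 <= (M + N).+1%:R^-1 - (M + N).+2%:R^-1 :> R.
  by move=> H; apply: le_trans (lerD IH H) _; rewrite addrA subrK.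
set k := (M + N)%N.
have k1 : (0 : R) < k.+1%:R by rewrite ltr0n.
have E : k.+2%:R = k.+1%:R + 1 :> R by rewrite natr1.
have -> : k.+1%:R^-1 - k.+2%:R^-1 = k.+1%:R^-1 * k.+2%:R^-1 :> R.
  by rewrite E; field; rewrite !gt_eqF// ltr_wpDr.
rewrite expr2 ler_pM2r ?invr_gt0 ?ltr0n//.
by rewrite lef_pV2 ?posrE ?ltr0n// ler_nat.
Qed.

Lemma sum_inv_sqr (N : nat) : \sum_(m < N) (m.+1%:R^-1) ^+ 2 <= 2 :> R.
Proof.
case: N => [|N]; first by rewrite big_ord0.
rewrite big_ord_recl /= invr1 expr1n.
rewrite (eq_bigr (fun m : 'I_N => ((0 + m).+2%:R^-1) ^+ 2 : R)) //.
have := sum_inv_sqr_tail 0 N; rewrite invr1.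
have : (0 : R) <= (0 + N).+1%:R^-1 by rewrite invr_ge0.
move: (_^-1) => u; move: (\sum_(_ < _) _) => v; lra.
Qed.

Lemma sum_half_pow (n : nat) : \sum_(d < n) 2^-1 ^+ d <= 2 :> R.
Proof.
suff : \sum_(d < n) 2^-1 ^+ d = 2 - 2 * 2^-1 ^+ n :> R.
  by move=> ->; rewrite gerBl mulr_ge0// exprn_ge0// invr_ge0.
elim: n => [|n IH]; first by rewrite big_ord0 expr0; lra.
by rewrite big_ord_recr /= IH exprS; lra.
Qed.

Lemma sum_half_dist (n j : nat) : (j < n)%N ->
  \sum_(i < n | (i <= j)%N) 2^-1 ^+ (j - i) <= 2 :> R.
Proof.
move=> jn; under eq_bigl do rewrite -ltnS.
rewrite -(big_ord_widen n (fun i => 2^-1 ^+ (j - i) : R) jn).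
rewrite (reindex_inj rev_ord_inj) /=.
rewrite (eq_bigr (fun d : 'I_j.+1 => 2^-1 ^+ d)) => [|d _]; first exact: sum_half_pow.
by rewrite subSS subKn// -ltnS ltn_ord.
Qed.

(** By symmetry only pairs with k.1 <= i.1 are treated, at the price of a factor 2. For such a pair,
    i and k.1 determine k.2, and the weight is at most a(i)^2 times 2^-(i.1 - k.1). The geometric
    series and the sum of inverse squares contribute a factor 2 each. *)
Lemma sum_eq_freq (L n N : nat) : (2 <= L)%N ->
  \sum_(i : 'I_n * 'I_N) \sum_(k : 'I_n * 'I_N)
    (i.2.+1 * L ^ i.1 == k.2.+1 * L ^ k.1)%N%:R * (i.2.+1%:R^-1 * k.2.+1%:R^-1)
  <= 8 * n%:R :> R.
Proof.
move=> L2.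
pose a (i : 'I_n * 'I_N) : R := i.2.+1%:R^-1.
have a0 i : 0 <= a i by rewrite invr_ge0.
pose K (i k : 'I_n * 'I_N) : R :=
  (i.2.+1 * L ^ i.1 == k.2.+1 * L ^ k.1)%N%:R * (a i * a k).
have Ksym i k : K i k = K k i by rewrite /K eq_sym [a i * _]mulrC.
have K0 i k : 0 <= K i k by rewrite mulr_ge0// mulr_ge0.
have half : \sum_(i : 'I_n * 'I_N) \sum_(k : 'I_n * 'I_N | (k.1 <= i.1)%N) K i k <= 4 * n%:R.
  have row (i : 'I_n * 'I_N) : \sum_(k : 'I_n * 'I_N | (k.1 <= i.1)%N) K i k <= 2 * a i ^+ 2.
    have -> : \sum_(k : 'I_n * 'I_N | (k.1 <= i.1)%N) K i k =
        \sum_(j < n | (j <= i.1)%N) \sum_(m < N) K i (j, m).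
      by rewrite pair_big_dep /=; apply: eq_big => [k|[j m] _]; rewrite ?andbT.
    apply: (@le_trans _ _ (\sum_(j < n | (j <= i.1)%N) a i ^+ 2 * 2^-1 ^+ (i.1 - j))).
      apply: ler_sum => j ji.
      (* The only index m for which (j, m) has the same frequency as i, provided it is below N. *)
      pose c := (i.2.+1 * L ^ (i.1 - j)).-1.
      have cE : c.+1 = (i.2.+1 * L ^ (i.1 - j))%N.
        by rewrite /c prednK// muln_gt0 expn_gt0; lia.
      have Keq (m : 'I_N) : K i (j, m) = if m == c :> nat then a i * c.+1%:R^-1 else 0.
        rewrite /K /a /=.
        have -> : (i.2.+1 * L ^ i.1 == m.+1 * L ^ j)%N = (m == c :> nat).
          rewrite -(subnK ji) expnD mulnA eqn_pmul2r ?expn_gt0; last by lia.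
          by rewrite -cE eqSS eq_sym.
        by case: eqP => [->|_]; rewrite ?mul1r ?mul0r.
      rewrite (eq_bigr _ (fun m _ => Keq m)) -big_mkcond /=.
      have cb : a i * c.+1%:R^-1 <= a i ^+ 2 * 2^-1 ^+ (i.1 - j).
        rewrite cE natrM invfM mulrA -expr2 ler_wpM2l ?sqr_ge0//.
        rewrite natrX exprVn lef_pV2 ?posrE ?exprn_gt0 ?ltr0n//; last by lia.
        by rewrite lerXn2r ?nnegrE ?ler0n// ler_nat.
      have [cN|Nc] := ltnP c N.
        by rewrite (big_pred1 (Ordinal cN)).
      rewrite big_pred0 => [|m]; last by apply/negbTE; have := ltn_ord m; lia.
      by rewrite mulr_ge0 ?sqr_ge0// exprn_ge0// invr_ge0.
    rewrite -mulr_sumr mulrC; apply: ler_wpM2r; first exact: sqr_ge0.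
    exact: sum_half_dist.
  apply: le_trans (ler_sum _ (fun i _ => row i)) _.
  rewrite -mulr_sumr.
  have -> : \sum_(i : 'I_n * 'I_N) a i ^+ 2 =
      \sum_(j < n) \sum_(m < N) (m.+1%:R^-1 : R) ^+ 2 by rewrite pair_big.
  rewrite sumr_const card_ord -mulr_natr.
  have := sum_inv_sqr N; move: (\sum_(m < N) _) => s s2.
  have : s * n%:R <= 2 * n%:R by rewrite ler_wpM2r.
  by lra.
apply: (@le_trans _ _ (\sum_(i : 'I_n * 'I_N) \sum_(k : 'I_n * 'I_N | (k.1 <= i.1)%N) K i k +
    \sum_(i : 'I_n * 'I_N) \sum_(k : 'I_n * 'I_N | (k.1 <= i.1)%N) K i k)); last by lra.
rewrite [X in _ <= _ + X](exchange_big_dep xpredT)//= -big_split /=.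
apply: ler_sum => i _; rewrite (bigID (fun k : 'I_n * 'I_N => (k.1 <= i.1)%N)) /=.
rewrite lerD2l (eq_bigr _ (fun k _ => Ksym i k)).
rewrite [leLHS]big_mkcond [leRHS]big_mkcond /=; apply: ler_sum => k _.
by case: (ltngtP k.1 i.1) => // _; rewrite -?/(K k i).
Qed.
End FrequencySums.

Section Averages.
Variable R : realType.
Local Notation C := R[i].
Local Notation normc := (ComplexField.Normc.normc).

(* Interpolation between consecutive squares: the sums of b - x j are monotone. *)
Lemma average_of_squares (x : nat -> R) (b : R) : (forall j, x j <= b) ->
  (fun m => (\sum_(j < m.+1 ^ 2) x j) / (m.+1 ^ 2)%:R) @ \oo --> (0 : R) ->
  (fun n => (\sum_(j < n) x j) / n%:R) @ \oo --> (0 : R).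
Proof.
move=> xb Hsq; pose s n := \sum_(j < n) x j.
have b0 : 0 <= `|b| by [].
have step m n : (m <= n)%N -> s n <= s m + `|b| * (n - m)%:R.
  move=> mn; rewrite -{1}(subnKC mn); elim: (n - m)%N => [|d IH].
    by rewrite addn0 mulr0 addr0.
  rewrite addnS /s big_ord_recr /= -/(s _) -natr1 mulrDr mulr1 addrA.
  by rewrite lerD//; apply: le_trans (xb _) (ler_norm _).
apply/cvgrPdist_le => e e0.
have e2 : 0 < e / 8 by rewrite divr_gt0.
have /cvgrPdist_le /(_ _ e2) [M _ HM] := Hsq.
have [M2 HM2] : exists M2 : nat, forall m, (M2 <= m)%N -> 3 * `|b| / m.+1%:R <= e / 2.
  exists (Num.truncn (6 * `|b| / e)) => m Mm.
  rewrite ler_pdivrMr ?ltr0n// mulrAC ler_pdivlMr//.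
  have : 6 * `|b| / e <= m.+1%:R.
    have : 6 * `|b| / e < (Num.truncn (6 * `|b| / e)).+1%:R.
      by apply: truncnS_gt.
    by move=> /ltW /le_trans; apply; rewrite ler_nat.
  by rewrite ler_pdivrMr//; lra.
exists ((M + M2).+1 ^ 2)%N => // n /= nM.
have [m m1 m2] : exists2 m, (m.+1 ^ 2 <= n)%N & (n < m.+2 ^ 2)%N.
  have n1 : (1 ^ 2 <= n)%N by apply: leq_trans nM; rewrite leq_exp2r.
  have ex : exists m, (m.+1 ^ 2 <= n)%N by exists 0%N.
  have ub m : (m.+1 ^ 2 <= n)%N -> (m <= n)%N.
    by move=> /(leq_trans _); apply; rewrite expnS expn1; lia.
  case: (ex_maxnP ex ub) => m m1 mmax; exists m => //.
  by rewrite ltnNge; apply/negP => /mmax; rewrite ltnn.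
have mM : (M + M2 <= m)%N.
  by have := leq_ltn_trans nM m2; rewrite ltn_exp2r// ltnS; lia.
have n0 : (0 : R) < n%:R by rewrite ltr0n; apply: leq_trans m1; rewrite expn_gt0.
have q0 : (0 : R) < (m.+1 ^ 2)%:R by rewrite ltr0n expn_gt0.
have h1 : `|s (m.+1 ^ 2)%N| <= e / 8 * (m.+1 ^ 2)%:R.
  have := HM m; rewrite /= sub0r normrN normrM normfV (gtr0_norm q0).
  by rewrite ler_pdivrMr//; apply; lia.
have h2 : `|s (m.+2 ^ 2)%N| <= e / 8 * (m.+2 ^ 2)%:R.
  have q1 : (0 : R) < (m.+2 ^ 2)%:R by rewrite ltr0n expn_gt0.
  have := HM m.+1; rewrite /= sub0r normrN normrM normfV (gtr0_norm q1).
  by rewrite ler_pdivrMr//; apply; lia.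
(* The ratio 4 of consecutive squares explains e/8: the next square costs 4 (e/8) = e/2, and the
   drift between the squares the other e/2. *)
have h3 : (m.+2 ^ 2)%:R <= 4 * (m.+1 ^ 2)%:R :> R.
  by rewrite -natrM ler_nat; rewrite !expnS !expn0 !muln1; nia.
have h4 : ((m.+2 ^ 2 - m.+1 ^ 2)%N)%:R * m.+1%:R <= 3 * (m.+1 ^ 2)%:R :> R.
  by rewrite -!natrM ler_nat; rewrite !expnS !expn0 !muln1; nia.
have h5 : `|b| * (m.+2 ^ 2 - m.+1 ^ 2)%:R <= e / 2 * (m.+1 ^ 2)%:R.
  have mp : (0 : R) < m.+1%:R by rewrite ltr0n.
  rewrite -(ler_pM2r mp).
  have hb := ler_wpM2l b0 h4.
  have := HM2 m; rewrite ler_pdivrMr// => /(_ _) h.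
  have {}h : 3 * `|b| <= e / 2 * m.+1%:R by exact: h (leq_trans (leq_addl _ _) mM).
  have := ler_wpM2r (ltW q0) h; move: hb; clear; lra.
rewrite sub0r normrN normrM normfV (gtr0_norm n0) ler_pdivrMr// -/(s n).
have nq : (m.+1 ^ 2)%:R <= n%:R :> R by rewrite ler_nat.
(* The preceding square bounds s(n) from above, the following one from below. *)
have u1 := step _ _ m1.
have u2 := step _ _ (ltnW m2).
have k1 : `|b| * (n - m.+1 ^ 2)%:R <= `|b| * (m.+2 ^ 2 - m.+1 ^ 2)%:R.
  by rewrite ler_wpM2l// ler_nat leq_sub2r// ltnW.
have k2 : `|b| * (m.+2 ^ 2 - n)%:R <= `|b| * (m.+2 ^ 2 - m.+1 ^ 2)%:R.
  by rewrite ler_wpM2l// ler_nat leq_sub2l.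
have k3 : e * (m.+1 ^ 2)%:R <= e * n%:R by rewrite ler_wpM2l// ltW.
have k4 : e / 8 * (m.+2 ^ 2)%:R <= e / 8 * (4 * (m.+1 ^ 2)%:R) by rewrite ler_wpM2l// ltW.
move: h1 h2; rewrite !ler_norml => /andP[h1a h1b] /andP[h2a h2b].
apply/andP; split; move: u1 u2 k1 k2 k3 k4 h5 h1a h1b h2a h2b; clear; lra.
Qed.
End Averages.

(** * Almost sure averages for one linear factor *)

Section StrongLaw.
Variable R : realType.
Local Notation C := R[i].
Local Notation normc := (ComplexField.Normc.normc).
Local Notation mu := (@lebesgue_measure R).
Variables (L : nat) (beta : C).
Hypotheses (L2 : (2 <= L)%N) (beta1 : normc beta <= 1).

Local Notation orbit x j := (expi2pi x ^+ (L ^ j)).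

Lemma normc_orbit (x : R) j : normc (orbit x j) = 1.
Proof. by rewrite normcX normc_expi2pi expr1n. Qed.

Lemma normc_beta_orbit x j : normc (beta * orbit x j) <= 1.
Proof. by rewrite ComplexField.Normc.normcM normc_orbit mulr1. Qed.

(** The functions W N have mean at most 1 by orthogonality, but take the value N wherever beta e(L^j
    x) = 1; such points violate the almost sure bound along a subsequence. *)
Lemma ae_orbit_neq1 : {ae mu, forall x : R, forall j, beta * orbit x j <> 1}.
Proof.
apply: ae_foralln => j.
pose W N (x : R) := N%:R^-1 * sqmod (\sum_(n < N) beta ^+ n * expi2pi x ^+ (n * L ^ j)).
have /choice[b bP] : forall N, exists b, has_mean (W N) b /\ b <= 1.
  move=> N.
  have [b hb bl] := has_mean_trig_poly (fun n : 'I_N => beta ^+ n) (fun n : 'I_N => n * L ^ j)%N.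
  exists (N%:R^-1 * b); split; first exact: has_meanZ.
  have [->|N0] := posnP N; first by rewrite invr0 mul0r.
  rewrite ler_pdivrMl ?ltr0n// mulr1; apply: le_trans bl _.
  apply: (@le_trans _ _ (\sum_(n < N) 1)); last by rewrite sumr_const card_ord.
  apply: ler_sum => n _.
  rewrite (bigD1 n)//= eqxx mul1r big1 ?addr0; last first.
    move=> m mn; rewrite eqn_pmul2r ?expn_gt0; last by lia.
    by rewrite (_ : (n == m :> nat) = false) ?mul0r//; apply/negbTE; rewrite eq_sym.
  by rewrite normcX mulr_ile1 ?exprn_ge0 ?normc_ge0// exprn_ile1 ?normc_ge0.
have W0 N x : 0 <= W N x by rewrite mulr_ge0 ?invr_ge0// sqmod_ge0.
have := ae_bounded_subsequence (fun N => (bP N).1) (fun N => (bP N).2) W0.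
apply: ae_imp => x [M HM] b1.
have [N NM] := HM (Num.truncn M).+2; apply/negP; rewrite -ltNge.
have N0 : (0 : R) < N%:R by rewrite ltr0n; lia.
rewrite /W (eq_bigr (fun=> 1)); last first.
  by move=> n _; rewrite mulnC exprM -exprMn b1 expr1n.
rewrite sumr_const card_ord.
have -> : sqmod (1 *+ N : C) = N%:R ^+ 2.
  have -> : 1 *+ N = (N%:R : R)%:C :> C by rewrite rmorph_nat.
  by rewrite sqmodE normc_real ger0_norm.
rewrite expr2 mulKf ?gt_eqF//; apply: lt_le_trans (truncnS_gt M) _.
by rewrite ler_nat (leq_trans _ NM).
Qed.

(** Coefficients and frequencies of the first N terms of - log(1 - beta z), summed over z = e(L^j x)
    with j < n. The map from pairs to frequencies need not be injective. *)
Definition log_coef (n N : nat) (i : 'I_n * 'I_N) : C := beta ^+ i.2.+1 * (i.2.+1%:R^-1)%:C.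
Definition log_freq (n N : nat) (i : 'I_n * 'I_N) : nat := (i.2.+1 * L ^ i.1)%N.
Definition log_poly (n N : nat) (x : R) : C :=
  \sum_(i : 'I_n * 'I_N) log_coef i * expi2pi x ^+ log_freq i.

Lemma Re_log_poly n N x : complex.Re (log_poly n N x) =
  \sum_(j < n) \sum_(m < N) complex.Re ((beta * orbit x j) ^+ m.+1) / m.+1%:R.
Proof.
rewrite raddf_sum /= pair_big /=; apply: eq_bigr => -[j m] _ /=.
rewrite /log_coef /log_freq /= mulnC exprM mulrAC -exprMn.
by case: (_ ^+ _) => u v /=; rewrite mulr0 subr0.
Qed.

(** The second moment is linear in n and uniform in the truncation N, as required for Fatou's
    lemma. *)
Lemma has_mean_log_poly n N :
  exists2 b, has_mean (fun x => sqmod (log_poly n N x)) b & b <= 8 * n%:R.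
Proof.
have [b hb bl] := has_mean_trig_poly (@log_coef n N) (@log_freq n N).
exists b => //; apply: le_trans bl _; apply: le_trans (sum_eq_freq R n N L2).
apply: ler_sum => i _; apply: ler_sum => k _; apply: ler_wpM2l => //.
have nc (l : 'I_n * 'I_N) : normc (log_coef l) <= l.2.+1%:R^-1.
  rewrite ComplexField.Normc.normcM normcX normc_real ger0_norm ?invr_ge0//.
  by rewrite ler_piMl ?invr_ge0// exprn_ile1 ?normc_ge0.
by apply: ler_pM; rewrite ?normc_ge0 ?nc.
Qed.

Lemma log_poly_cvg n x : (forall j, beta * orbit x j <> 1) ->
  (fun N => complex.Re (log_poly n N x)) @ \oo -->
     - \sum_(j < n) ln (normc (1 - beta * orbit x j)).
Proof.
move=> H; rewrite -sumrN.
rewrite (_ : (fun N => _) = (fun N => \sum_(j < n)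
   \sum_(m < N) complex.Re ((beta * orbit x j) ^+ m.+1) / m.+1%:R)); last first.
  by apply/funext => N; rewrite Re_log_poly.
apply: cvg_big => [|j _]; first exact: add_continuous.
apply/cvgrPdist_le => e e0.
set w := beta * orbit x j.
have w1 : w != 1 by apply/eqP; apply: H.
set c := 2 / normc (1 - w).
exists (Num.truncn (c / e)) => // N /= cN.
rewrite -opprD normrN; apply: le_trans (log_series_bound N _ w1) _.
  exact: normc_beta_orbit.
rewrite -/c ler_pdivrMr ?ltr0n// mulrC -ler_pdivrMr//.
by apply: le_trans (ltW (truncnS_gt _)) _; rewrite ler_nat.
Qed.

Theorem strong_law_log : {ae mu, forall x : R, (forall j, beta * orbit x j <> 1) /\
  (fun n => (\sum_(j < n) ln (normc (1 - beta * orbit x j))) / n%:R) @ \oo --> (0 : R)}.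
Proof.
(* The squared averages along the squares (m + 1)^2, truncated and summed. Their means are at most 8
   / (m + 1)^2, with total at most 16. *)
pose V N (x : R) := \sum_(m < N) (m.+1%:R ^- 4) * sqmod (log_poly (m.+1 ^ 2) N x).
have /choice[b bP] : forall N, exists b, has_mean (V N) b /\ b <= 16.
  move=> N.
  have /choice[c cP] : forall m : 'I_N, exists c,
      has_mean (fun x => sqmod (log_poly (m.+1 ^ 2) N x)) c /\ c <= 8 * (m.+1 ^ 2)%:R.
    move=> m; by have [c] := has_mean_log_poly (m.+1 ^ 2) N; exists c.
  exists (\sum_(m < N) (m.+1%:R ^- 4) * c m); split.
    by apply: has_mean_sum => m _; apply: has_meanZ; exact: (cP m).1.
  have := sum_inv_sqr R N; rewrite -(ler_pM2l (_ : 0 < 8))// => h.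
  apply: le_trans (le_trans h _); last by lra.
  rewrite mulr_sumr; apply: ler_sum => m _.
  have m0 : (0 : R) < m.+1%:R by rewrite ltr0n.
  rewrite exprVn ler_pdivrMl ?exprn_gt0//; apply: le_trans (cP m).2 _.
  by rewrite natrX le_eqVlt; apply/orP; left; apply/eqP; field; rewrite nat1r gt_eqF.
have V0 N x : 0 <= V N x.
  by apply: sumr_ge0 => m _; rewrite mulr_ge0 ?sqmod_ge0// invr_ge0 exprn_ge0.
have := ae_and ae_orbit_neq1
  (ae_bounded_subsequence (fun N => (bP N).1) (fun N => (bP N).2) V0).
apply: ae_imp => x [H [M HM]]; split => //.
have fb j : ln (normc (1 - beta * orbit x j)) <= ln 2.
  have w1 : 1 - beta * orbit x j != 0 by rewrite subr_eq0 eq_sym; apply/eqP.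
  rewrite ler_ln ?posrE//.
    apply: le_trans (le_normcD _ _) _; rewrite normcN ComplexField.Normc.normc1.
    by have := normc_beta_orbit x j; lra.
  rewrite lt_neqAle normc_ge0 andbT eq_sym; apply: contra w1.
  by move=> /eqP /ComplexField.Normc.eq0_normc ->.
apply: average_of_squares fb _.
pose y m := (\sum_(j < m.+1 ^ 2) ln (normc (1 - beta * orbit x j))) / (m.+1 ^ 2)%:R.
(* For fixed K the squared real parts in the first K terms of V N converge to this sum as N grows,
   while V N <= M for arbitrarily large N. Hence the squares of y are summable and y tends to 0. *)
have partial K : \sum_(0 <= m < K) y m ^+ 2 <= M.
  rewrite leNgt; apply/negP => Mlt.
  have cv : (fun N => \sum_(m < K) (m.+1%:R ^- 4) *
      complex.Re (log_poly (m.+1 ^ 2) N x) ^+ 2) @ \oo --> \sum_(0 <= m < K) y m ^+ 2.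
    rewrite big_mkord; apply: cvg_big => [|m _]; first exact: add_continuous.
    have -> : y m ^+ 2 = m.+1%:R ^- 4 *
       (- \sum_(j < m.+1 ^ 2) ln (normc (1 - beta * orbit x j))) ^+ 2.
      rewrite /y sqrrN; move: (\sum_(j < _) _) => s.
      by rewrite natrX; field; rewrite nat1r pnatr_eq0.
    apply: cvgMr; rewrite expr2; under eq_cvg do rewrite expr2.
    by apply: cvgM; apply: log_poly_cvg.
  have [N1 _ HN1] := cvgr_gt _ cv _ Mlt.
  have [N NN VN] := HM (maxn N1 K).
  have := HN1 N; rewrite /= ltNge => /(_ _)/negP; apply; first by lia.
  apply: le_trans VN.
  have KN : (K <= N)%N by lia.
  rewrite /V (big_ord_widen N (fun m => m.+1%:R ^- 4 *
     complex.Re (log_poly (m.+1 ^ 2) N x) ^+ 2) KN) big_mkcond /=.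
  apply: ler_sum => m _; case: ifP => _; last first.
    by rewrite mulr_ge0 ?sqmod_ge0// invr_ge0 exprn_ge0.
  by rewrite ler_wpM2l ?invr_ge0 ?exprn_ge0// lerDl sqr_ge0.
have cvgy2 : cvgn (series (fun m => y m ^+ 2)).
  apply: nondecreasing_is_cvgn.
    by apply: nondecreasing_series => m _ _; rewrite sqr_ge0.
  by exists M => _ [K _ <-]; apply: partial.
have /cvgrPdist_le y20 := cvg_series_cvg_0 cvgy2.
apply/cvgrPdist_le => e e0; have e20 : 0 < e ^+ 2 by rewrite exprn_gt0.
have [N0 _ HN0] := y20 _ e20; exists N0 => // m /= mN.
have := HN0 m mN; rewrite /= !sub0r !normrN normrX.
by rewrite ler_pXn2r ?nnegrE// ltW.
Qed.
End StrongLaw.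

(** * Jensen's formula and the strong law for polynomials *)

Section Jensen.
Variable R : realType.
Local Notation C := R[i].
Local Notation normc := (ComplexField.Normc.normc).
Local Notation mu := (@lebesgue_measure R).
Local Notation D := (`[0%R, 1%R]%classic : set R).

Lemma fatou_bound (V : nat -> R -> R) (b : nat -> R) (B : R) (g : R -> R) :
  (forall N, has_mean (V N) (b N)) -> (forall N, b N <= B) ->
  (forall N x, 0 <= V N x) -> measurable_fun D g -> (forall x, 0 <= g x) ->
  {ae mu, forall x : R, forall e, 0 < e -> \forall N \near \oo, g x - e <= V N x} ->
  (\int[mu]_(x in D) (g x)%:E <= B%:E)%E.
Proof.
move=> HV bB V0 mg g0 gV.
have [] := has_mean_fatou 0 HV bB V0; rewrite add0r => mL L0 LB.
apply: le_trans LB; apply: (@ae_ge0_le_integral _ _ _ mu D) => //.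
- by move=> x _; rewrite lee_fin.
- exact/measurable_EFinP.
- apply: ae_imp gV => x Hx _; apply/lee_addgt0Pr => e e0.
  have [N0 _ HN0] := Hx _ e0.
  rewrite -leeBlDr// limn_einf_lim; apply: lime_ge; first exact: is_cvg_einfs.
  exists N0 => // n /= nN; apply: le_ereal_inf_tmp => _ [m /= nm <-].
  by rewrite -EFinB lee_fin; apply: HN0; rewrite /= (leq_trans nN).
Qed.

Definition has_int (f : R -> R) (v : R) :=
  mu.-integrable D (EFin \o f) /\ (\int[mu]_(x in D) (f x)%:E)%E = v%:E.

Lemma has_int_mean V b : has_mean V b -> has_int V b.
Proof.
move=> HV; split; last by have := has_mean_integral 0 HV; rewrite add0r.
apply: continuous_compact_integrable; first exact: segment_compact.
by apply: continuous_subspaceT; have [] := HV.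
Qed.

Lemma has_intD f g v w : has_int f v -> has_int g w ->
  has_int (fun x => f x + g x) (v + w).
Proof.
move=> [fi fv] [gi gw].
split; first exact: (@integrableD _ _ _ mu D (measurable_itv _) _ _ fi gi).
under eq_integral do rewrite EFinD.
by rewrite (@integralD _ _ _ mu D (measurable_itv _) _ _ fi gi) fv gw.
Qed.

(** The right-hand side is what |t| <= e + t^2 / (4 e) makes of a second moment 1/(N+1). If v is the
    integral of f, then e = |v|/2 and N + 1 > |v|^-2 contradict v != 0. *)
Lemma has_int_cvg0 (f : R -> R) (g : nat -> R -> R) :
  measurable_fun D f -> (forall N, has_mean (g N) 0) ->
  (forall (e : R) N, 0 < e ->
     (\int[mu]_(x in D) `|f x + g N x|%:E <= (e + (4 * e * N.+1%:R)^-1)%:E)%E) ->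
  has_int f 0.
Proof.
move=> mf g0 H.
have mg N : measurable_fun D (g N).
  by apply: measurable_funTS; apply: continuous_measurable_fun; have [] := g0 N.
have ih N : mu.-integrable D (EFin \o (fun x => f x + g N x)).
  apply/integrableP; split.
    by apply/measurable_EFinP; apply: measurable_funD; [exact: mf|exact: mg].
  by apply: le_lt_trans (H 1 N ltr01) _; rewrite ltry.
have iff : mu.-integrable D (EFin \o f).
  have [gi _] := has_int_mean (has_meanZ (-1) (g0 0%N)).
  have := @integrableD _ _ _ mu D (measurable_itv _) _ _ (ih 0%N) gi.
  by congr (is_true (integrable _ _ _)); apply/funext => x /=; rewrite -EFinD mulN1r addrK.
have [v vE] : exists v, (\int[mu]_(x in D) (f x)%:E)%E = v%:E.
  have := @integrable_fin_num _ _ _ mu D (measurable_itv _) _ iff.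
  by case: (integral _ _ _) => // v _; exists v.
split; rewrite // vE; congr EFin; apply/eqP; apply: contrapT => /negP v0.
have {}v0 : 0 < `|v| by rewrite normr_gt0.
have vle e N : 0 < e -> `|v| <= e + (4 * e * N.+1%:R)^-1.
  move=> e0; have [_ hv] := has_intD (conj iff vE) (has_int_mean (g0 N)).
  rewrite -lee_fin; apply: le_trans (H e N e0).
  rewrite addr0 in hv; rewrite -abse_EFin -hv.
  exact: (@le_abse_integral _ _ _ mu D _ (measurable_itv _) (measurable_int mu (ih N))).
pose N := Num.truncn (`|v| ^- 2).
have hN : `|v| ^- 2 < N.+1%:R by apply: truncnS_gt.
have N0 : (0 : R) < N.+1%:R by rewrite ltr0n.
have v2 : 0 < `|v| / 2 by rewrite divr_gt0.
have := vle (`|v| / 2) N v2.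
have -> : 4 * (`|v| / 2) * N.+1%:R = 2 * (`|v| * N.+1%:R) by lra.
have : (`|v| * N.+1%:R)^-1 < `|v|.
  rewrite invf_plt ?posrE ?mulr_gt0// -ltr_pdivrMl//.
  by apply: le_lt_trans hN; rewrite expr2 invfM.
rewrite [(2 * _)^-1]invfM; move: (_ * N.+1%:R)^-1 => u; lra.
Qed.

End Jensen.

(** * Jensen's formula for one linear factor *)

Section JensenFactor.
Variable R : realType.
Local Notation C := R[i].
Local Notation normc := (ComplexField.Normc.normc).
Local Notation mu := (@lebesgue_measure R).
Local Notation D := (`[0%R, 1%R]%classic : set R).

Lemma has_mean_Re_trig (N : nat) (c : nat -> C) :
  has_mean (fun x : R => \sum_(m < N) complex.Re (c m * expi2pi x ^+ m.+1)) 0.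
Proof.
have E0 : 0 = \sum_(m < N) (0 : R) by rewrite big1.
rewrite [X in has_mean _ X]E0.
apply: has_mean_sum => m _.
have := @has_mean_trig R (complex.Re (c m)) (- complex.Im (c m)) m.+1%:Z isT.
congr has_mean; apply/funext => x.
have := Re_trig_pair (c m) 1 m.+1 0 x.
by rewrite expr0 mulr1 rmorph1 !mulr1 subr0 => ->.
Qed.

Lemma measurable_ln_factor (beta : C) :
  measurable_fun D (fun x : R => ln (normc (1 - beta * expi2pi x))).
Proof.
pose c (i : 'I_2) : C := if i == ord0 then 1 else - beta.
have [b [cV _] _] := has_mean_trig_poly c (@nat_of_ord 2).
rewrite (_ : (fun x => _) = (fun x => ln (Num.sqrt
   (sqmod (\sum_i c i * expi2pi x ^+ i))))); last first.
  apply/funext => x; rewrite big_ord_recl big_ord1 /c /= expr0 mulr1 expr1 mulNr.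
  by case: (1 - _).
apply: measurable_funTS; apply: measurableT_comp; first exact: measurable_ln.
apply: measurableT_comp; first exact: (continuous_measurable_fun (@sqrt_continuous R)).
exact: continuous_measurable_fun.
Qed.

(** Minus the truncated Fourier series T is a trigonometric polynomial without constant term, and
    the remaining tail has second moment at most 1/(N+1). Fatou's lemma carries this from the finite
    pieces [Dl] of the tail to f + T. *)
Lemma has_int_ln_factor (beta : C) : normc beta <= 1 ->
  has_int (fun x : R => ln (normc (1 - beta * expi2pi x))) 0.
Proof.
move=> b1; set f := fun x : R => _.
pose c (m : nat) : C := beta ^+ m.+1 * (m.+1%:R^-1)%:C.
pose T N (x : R) := \sum_(m < N) complex.Re (c m * expi2pi x ^+ m.+1).
have cN m : normc (c m) <= m.+1%:R^-1.
  rewrite ComplexField.Normc.normcM normcX normc_real ger0_norm ?invr_ge0//.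
  by rewrite ler_piMl ?invr_ge0// exprn_ile1 ?normc_ge0.
apply: (has_int_cvg0 (g := fun N => T N.+1)).
- exact: measurable_ln_factor.
- by move=> N; apply: has_mean_Re_trig.
move=> e N e0.
pose Dl M (x : R) := \sum_(m < M) c (N.+1 + m)%N * expi2pi x ^+ (N.+1 + m).+1.
pose V M (x : R) := e + (4 * e)^-1 * sqmod (Dl M x).
have e4 : 0 < 4 * e by rewrite mulr_gt0.
have /choice[b bP] : forall M, exists b, has_mean (V M) b /\
    b <= e + (4 * e * N.+1%:R)^-1.
  move=> M.
  have [b hb bl] := has_mean_trig_poly (fun m : 'I_M => c (N.+1 + m)%N)
     (fun m : 'I_M => (N.+1 + m).+1).
  exists (e + (4 * e)^-1 * b); split.
    by apply: has_meanD; [exact: has_mean_const|exact: has_meanZ].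
  rewrite lerD2l [(_ * N.+1%:R)^-1]invfM ler_pM2l ?invr_gt0//; apply: le_trans bl _.
  apply: (@le_trans _ _ (\sum_(m < M) ((N + m).+2%:R^-1) ^+ 2)).
    apply: ler_sum => m _; rewrite (bigD1 m)//= eqxx mul1r big1 ?addr0.
      by apply: ler_pM; rewrite ?normc_ge0// ?addSn; exact: cN.
    move=> k km; rewrite eqSS eqn_add2l (_ : (m == k :> nat) = false) ?mul0r//.
    by apply/negbTE; rewrite eq_sym.
  apply: le_trans (sum_inv_sqr_tail R N M) _.
  by rewrite gerBl invr_ge0.
apply: (fatou_bound (V := V) (fun M => (bP M).1) (fun M => (bP M).2)).
- move=> M x; apply: addr_ge0; first exact: ltW.
  by rewrite mulr_ge0 ?sqmod_ge0// invr_ge0 ltW.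
- apply: measurableT_comp => //; apply: measurable_funD.
    exact: measurable_ln_factor.
  apply: measurable_funTS; apply: continuous_measurable_fun.
  by have [] := has_mean_Re_trig N.+1 c.
- by [].
have := @ae_orbit_neq1 R 2 beta isT b1; apply: ae_imp => x /(_ 0%N).
rewrite expn0 expr1 => w1 d d0.
have Tcvg : (fun M => T M x) @ \oo --> - f x.
  apply/cvgrPdist_le => r r0.
  have w1' : beta * expi2pi x != 1 by apply/eqP.
  exists (Num.truncn (2 / normc (1 - beta * expi2pi x) / r)) => // M /= cM.
  rewrite -opprD normrN /T.
  rewrite (eq_bigr (fun m : 'I_M => complex.Re ((beta * expi2pi x) ^+ m.+1) / m.+1%:R)).
    apply: le_trans (log_series_bound M _ w1') _.
      by rewrite ComplexField.Normc.normcM normc_expi2pi mulr1.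
    rewrite ler_pdivrMr ?ltr0n// [r * _]mulrC -ler_pdivrMr//.
    by apply: le_trans (ltW (truncnS_gt _)) _; rewrite ler_nat.
  move=> m _; rewrite /c mulrAC -exprMn.
  by case: (_ ^+ _) => u v /=; rewrite mulr0 subr0.
have Dlcvg : (fun M => complex.Re (Dl M x)) @ \oo --> - f x - T N.+1 x.
  have E M : complex.Re (Dl M x) = T (M + N.+1)%N x - T N.+1 x.
    by rewrite addnC /T big_split_ord /= addrAC subrr add0r raddf_sum.
  rewrite (_ : (fun M => _) = (fun M => T (M + N.+1)%N x - T N.+1 x)); last exact/funext.
  by apply: cvgB; [by rewrite (cvg_shiftn N.+1 (fun M => T M x))|exact: cvg_cst].
have /cvgrPdist_le /(_ _ d0) [M0 _ HM0] := Dlcvg.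
exists M0 => // M /= /HM0; rewrite -opprD -opprD normrN => hM.
have h1 : `|f x + T N.+1 x| <= d + `|complex.Re (Dl M x)|.
  rewrite -[f x + _](addrK (complex.Re (Dl M x))).
  by apply: le_trans (ler_normB _ _) _; rewrite lerD2r.
have h2 : `|complex.Re (Dl M x)| <= e + (4 * e)^-1 * complex.Re (Dl M x) ^+ 2.
  rewrite -subr_ge0 -(pmulr_rge0 _ e4) -[_ ^+ 2]real_normK ?num_real//.
  have -> : 4 * e * (e + (4 * e)^-1 * `|complex.Re (Dl M x)| ^+ 2 - `|complex.Re (Dl M x)|) =
    (2 * e - `|complex.Re (Dl M x)|) ^+ 2 by field; rewrite gt_eqF.
  exact: sqr_ge0.
have h3 : (4 * e)^-1 * complex.Re (Dl M x) ^+ 2 <= (4 * e)^-1 * sqmod (Dl M x).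
  apply: ler_wpM2l; first by rewrite invr_ge0 ltW.
  by rewrite /sqmod lerDl sqr_ge0.
by move: h1 h2 h3; rewrite /V; clear; lra.
Qed.

Lemma linear_factor (a : C) : exists2 beta : C, normc beta <= 1 &
  forall z, normc z = 1 -> normc (z - a) = Num.max 1 (normc a) * normc (1 - beta * z).
Proof.
have [a1|a1] := leP (normc a) 1.
  exists a^*; first by move: a1; case: (a) => u v; rewrite /= sqrrN.
  move=> z z1.
  have conjN (y : C) : normc y^* = normc y by case: y => u v; rewrite /= sqrrN.
  have zz : z * z^* = 1 by rewrite conjc_mul_self sqmodE z1 expr1n.
  have -> : z - a = z * (1 - a^* * z)^*.
    have -> : z - a = z - a * (z * z^*) by rewrite zz mulr1.
    clear; case: z a => [u v] [s t].
    by apply/eqP; rewrite eq_complex /=; apply/andP; split; apply/eqP; ring.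
  by rewrite ComplexField.Normc.normcM z1 conjN.
have a0 : a != 0.
  by apply: contraTneq a1 => ->; rewrite ComplexField.Normc.normc0 ltr10.
exists a^-1; first by rewrite ComplexField.Normc.normcV invf_le1 ?ltW// (lt_trans ltr01).
move=> z z1.
rewrite -ComplexField.Normc.normcM -normcN; congr normc.
by rewrite mulrBr mulr1 mulVKf// opprB.
Qed.
End JensenFactor.

(** * Products of linear factors *)

Section PolynomialLaw.
Variable R : realType.
Local Notation C := R[i].
Local Notation normc := (ComplexField.Normc.normc).
Local Notation mu := (@lebesgue_measure R).
Local Notation D := (`[0%R, 1%R]%classic : set R).
Implicit Types (rs : seq C) (p : {poly C}).

(** Jensen's expression for the logarithmic Mahler measure in terms of the leading coefficient and
    the zeros. *)
Definition mahler_value (c : C) rs : R :=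
  ln (normc c) + \sum_(a <- rs) ln (Num.max 1 (normc a)).

Lemma normc_eq0 (z : C) : (normc z == 0) = (z == 0).
Proof.
apply/eqP/eqP => [/ComplexField.Normc.eq0_normc //|->].
exact: ComplexField.Normc.normc0.
Qed.

Lemma normc_gt0 (z : C) : (0 < normc z) = (z != 0).
Proof. by rewrite lt_neqAle normc_ge0 andbT eq_sym normc_eq0. Qed.

Lemma max1_gt0 (a : C) : 0 < Num.max 1 (normc a).
Proof. by rewrite lt_max ltr01. Qed.

Lemma ln_normc_factor (a beta z : C) (r : R) :
  normc (z - a) = Num.max 1 (normc a) * normc (1 - beta * z) ->
  beta * z != 1 -> 0 < r ->
  0 < normc (z - a) * r /\
  ln (normc (z - a) * r) =
    ln (Num.max 1 (normc a)) + ln (normc (1 - beta * z)) + ln r.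
Proof.
move=> E bz r0.
have n0 : 0 < normc (1 - beta * z) by rewrite normc_gt0 subr_eq0 eq_sym.
have m0 := max1_gt0 a.
by split; rewrite E ?mulr_gt0// !lnM ?posrE ?mulr_gt0.
Qed.

Lemma strong_law_poly (L : nat) (c : C) rs : (2 <= L)%N -> c != 0 ->
  let p := c *: \prod_(a <- rs) ('X - a%:P) in
  {ae mu, forall x : R, (forall j, p.[expi2pi x ^+ (L ^ j)] != 0) /\
    (fun n => (\sum_(j < n) ln (normc p.[expi2pi x ^+ (L ^ j)])) / n%:R)
       @ \oo --> mahler_value c rs}.
Proof.
move=> L2 c0 /=.
elim: rs => [|a rs IH].
  apply: aeW => x; split=> [j|].
    by rewrite big_nil hornerZ hornerC mulr1.
  have -> : mahler_value c [::] = ln (normc c) by rewrite /mahler_value big_nil addr0.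
  apply/cvgrPdist_le => e e0; exists 1%N => // n /= n1.
  rewrite (eq_bigr (fun=> ln (normc c))); last first.
    by move=> j _; rewrite big_nil hornerZ hornerC mulr1.
  rewrite sumr_const card_ord -[ln _ *+ n]mulr_natr mulfK ?subrr ?normr0 ?ltW//.
  by rewrite pnatr_eq0 -lt0n.
have [beta b1 bE] := linear_factor a.
apply: ae_imp (ae_and IH (strong_law_log L2 b1)) => x [[p0 pcvg] [b0 bcvg]].
have pE j : normc (c *: \prod_(a <- a :: rs) ('X - a%:P)).[expi2pi x ^+ (L ^ j)] =
    normc (expi2pi x ^+ (L ^ j) - a) *
    normc (c *: \prod_(a <- rs) ('X - a%:P)).[expi2pi x ^+ (L ^ j)].
  rewrite big_cons !hornerZ hornerM hornerXsubC mulrCA.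
  by rewrite ComplexField.Normc.normcM.
have fac j := ln_normc_factor (bE _ (normc_orbit L x j)) (introN eqP (b0 j)) 
   (etrans (normc_gt0 _) (p0 j)).
split=> [j|]; first by rewrite -normc_gt0 pE; exact: (fac j).1.
have -> : mahler_value c (a :: rs) = ln (Num.max 1 (normc a)) + 0 + mahler_value c rs.
  by rewrite /mahler_value big_cons addr0 addrCA.
pose s1 n := (\sum_(j < n) ln (normc (1 - beta * expi2pi x ^+ (L ^ j)))) / n%:R.
pose s2 n := (\sum_(j < n) ln (normc (c *: \prod_(a <- rs)
  ('X - a%:P)).[expi2pi x ^+ (L ^ j)])) / n%:R.
have H : (fun n => ln (Num.max 1 (normc a)) + s1 n + s2 n) @ \oo -->
    ln (Num.max 1 (normc a)) + 0 + mahler_value c rs.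
  by apply: cvgD; [apply: cvgD => //; exact: cvg_cst|].
apply: (cvg_trans _ H); apply: near_eq_cvg; exists 1%N => // n /= n1.
rewrite (eq_bigr _ (fun (j : 'I_n) _ => etrans (congr1 (@ln R) (pE j)) (fac j).2)).
rewrite !big_split /= !mulrDl sumr_const card_ord -[_ *+ n]mulr_natr mulfK//.
by rewrite pnatr_eq0 -lt0n.
Qed.

(** The logarithm of a product splits only away from the zeros. The integral is therefore computed
    for a real-valued f that agrees with ln |p| almost everywhere. *)
Lemma has_int_log_poly (c : C) rs : c != 0 ->
  exists2 f : R -> R, has_int f (mahler_value c rs) &
   {ae mu, forall x : R, let z := (c *: \prod_(a <- rs) ('X - a%:P)).[expi2pi x] in
     z != 0 /\ ln (normc z) = f x}.
Proof.
move=> c0; elim: rs => [|a rs [f fi fE]].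
  exists (fun=> ln (normc c)).
    by rewrite /mahler_value big_nil addr0; apply/has_int_mean/has_mean_const.
  by apply: aeW => x /=; rewrite big_nil hornerZ hornerC mulr1.
have [beta b1 bE] := linear_factor a.
exists (fun x => ln (Num.max 1 (normc a)) + ln (normc (1 - beta * expi2pi x)) + f x).
  have -> : mahler_value c (a :: rs) = ln (Num.max 1 (normc a)) + 0 + mahler_value c rs.
    by rewrite /mahler_value big_cons addr0 addrCA.
  apply: has_intD => //; apply: has_intD; last exact: has_int_ln_factor.
  exact/has_int_mean/has_mean_const.
apply: ae_imp (ae_and fE (ae_orbit_neq1 (isT : (2 <= 2)%N) b1)) => x /= [[z0 zf] b0].
have {}b0 : beta * expi2pi x != 1 by apply/eqP; have := b0 0%N; rewrite expn0 expr1.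
have [g0 gE] := ln_normc_factor (bE _ (normc_expi2pi x)) b0 (etrans (normc_gt0 _) z0).
rewrite big_cons hornerZ hornerM hornerXsubC mulrCA -hornerZ -normc_gt0.
by rewrite ComplexField.Normc.normcM gE zf.
Qed.

Lemma measurable_lne_poly p :
  measurable_fun D (fun x : R => lne (normc p.[expi2pi x])%:E).
Proof.
apply: measurable_funTS.
have [b [cV _] _] := has_mean_trig_poly (fun i : 'I_(size p) => p`_i)
  (fun i : 'I_(size p) => nat_of_ord i).
have mn : measurable_fun setT (fun x : R => normc p.[expi2pi x]).
  rewrite (_ : (fun x => _) = (fun x => Num.sqrt
     (sqmod (\sum_(i < size p) p`_i * expi2pi x ^+ i)))); last first.
    by apply/funext => x; rewrite horner_coef; case: (\sum_(i < _) _).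
  apply: measurableT_comp; first exact: (continuous_measurable_fun (@sqrt_continuous R)).
  exact: continuous_measurable_fun.
rewrite (_ : (fun x => _) = (fun x => if normc p.[expi2pi x] <= 0 then -oo%E
   else (ln (normc p.[expi2pi x]))%:E)); last by [].
apply: measurable_fun_ifT => //.
  by apply: measurable_fun_ler.
apply/measurable_EFinP; apply: measurableT_comp mn; exact: measurable_ln.
Qed.

Theorem log_mahler_roots (c : C) rs : c != 0 ->
  log_mahler (c *: \prod_(a <- rs) ('X - a%:P)) = (mahler_value c rs)%:E.
Proof.
move=> c0; have [f [fi fv] fE] := has_int_log_poly rs c0.
rewrite /log_mahler -fv.
apply: (@ae_eq_integral _ _ _ mu D).
- exact: measurable_itv.
- exact: measurable_lne_poly.
- exact: (measurable_int mu fi).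
- by apply: ae_imp fE => x [z0 <-] _; rewrite [LHS]lne_EFin// normc_gt0.
Qed.
End PolynomialLaw.

(** * Lyapunov exponents of the cocycle *)

Section Growth.
Variable R : realType.
Implicit Types (A U V : nat -> R) (m l e K : R).

(** Exponential growth rate at most m; a one-sided notion, stable under the operations of the
    recursion for the cocycle. *)
Definition grows U m := forall e, 0 < e ->
  exists2 K, 0 < K & forall n, U n <= K * expR ((m + e) * n%:R).

Lemma grows_avg A m : (fun n => A n / n%:R) @ \oo --> m ->
  grows (fun n => expR (A n)) m.
Proof.
move=> /cvgrPdist_le cA e e0; have [N _ HN] := cA _ e0.
pose B := \sum_(i < N.+1) `|A i - (m + e) * i%:R|.
exists (expR B); first exact: expR_gt0.
move=> n; rewrite -expRD ler_expR.
have [nN|Nn] := ltnP n N.+1.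
  have : `|A n - (m + e) * n%:R| <= B.
    rewrite /B (bigD1 (Ordinal nN))//= lerDl sumr_ge0//.
  by move=> /(le_trans (ler_norm _)); rewrite lerBlDr.
apply: (@le_trans _ _ (0 + (m + e) * n%:R)); last by rewrite lerD2r sumr_ge0.
have n0 : (0 : R) < n%:R by rewrite ltr0n; lia.
have := HN n (ltnW Nn); rewrite ler_distlC => /andP[_].
by rewrite ler_pdivrMr// add0r.
Qed.

Lemma growsD U V m : grows U m -> grows V m -> grows (fun n => U n + V n) m.
Proof.
move=> HU HV e e0; have [K K0 HK] := HU _ e0; have [K' K'0 HK'] := HV _ e0.
exists (K + K'); first exact: addr_gt0.
by move=> n; rewrite mulrDl lerD.
Qed.

Lemma growsZ (c : R) U m : 0 <= c -> grows U m -> grows (fun n => c * U n) m.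
Proof.
move=> c0 HU e e0; have [K K0 HK] := HU _ e0.
exists ((c + 1) * K); first by rewrite mulr_gt0// ltr_wpDl.
move=> n; apply: le_trans (ler_wpM2l c0 (HK n)) _.
by rewrite mulrA ler_wpM2r ?expR_ge0// ler_wpM2r ?(ltW K0)// lerDl.
Qed.

Lemma growsM U V m l : (forall n, 0 <= U n) -> (forall n, 0 <= V n) ->
  grows U m -> grows V l -> grows (fun n => U n * V n) (m + l).
Proof.
move=> U0 V0 HU HV e e0; have e2 : 0 < e / 2 by rewrite divr_gt0.
have [K K0 HK] := HU _ e2; have [K' K'0 HK'] := HV _ e2.
exists (K * K'); first exact: mulr_gt0.
move=> n; have -> : (m + l + e) * n%:R = (m + e / 2) * n%:R + (l + e / 2) * n%:R by lra.
by rewrite expRD mulrACA ler_pM.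
Qed.

Lemma grows_shift U m : grows U m -> grows (fun n => U n.+1) m.
Proof.
move=> HU e e0; have [K K0 HK] := HU _ e0.
exists (K * expR (m + e)); first by rewrite mulr_gt0 ?expR_gt0.
move=> n; apply: le_trans (HK _) _.
by rewrite -natr1 mulrDr mulr1 [expR (_ + (m + e))]expRD [_ * expR (m + e)]mulrC mulrA.
Qed.

Lemma grows_le U V m : (forall n, U n <= V n) -> grows V m -> grows U m.
Proof.
move=> UV HV e e0; have [K K0 HK] := HV _ e0.
by exists K => // n; apply: le_trans (UV n) (HK n).
Qed.

Lemma grows_cst (c m : R) : 0 <= m -> grows (fun=> c) m.
Proof.
move=> m0 e e0; exists (`|c| + 1); first by rewrite ltr_wpDl.
move=> n; have : 1 <= expR ((m + e) * n%:R).
  by rewrite -expR0 ler_expR mulr_ge0// addr_ge0// ltW.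
have := ler_norm c; have := normr_ge0 c; move: (expR _) => E; nra.
Qed.

(** With half of e spent on each term, the number n of terms is absorbed by exp(e n / 2) >= 1 + e n
    / 2. *)
Lemma grows_sum U m : 0 <= m -> (forall n, 0 <= U n) -> grows U m ->
  grows (fun n => \sum_(i < n) U i) m.
Proof.
move=> m0 U0 HU e e0; have e2 : 0 < e / 2 by rewrite divr_gt0.
have [K K0 HK] := HU _ e2.
exists (K * (e / 2)^-1); first by rewrite mulr_gt0// invr_gt0.
move=> n; apply: (@le_trans _ _ (\sum_(i < n) K * expR ((m + e / 2) * n%:R))).
  apply: ler_sum => i _; apply: le_trans (HK i) _.
  rewrite ler_wpM2l ?(ltW K0)// ler_expR ler_wpM2l ?ler_nat ?(ltnW (ltn_ord i))//.
  by rewrite addr_ge0// (ltW e2).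
rewrite sumr_const card_ord -[_ *+ n]mulr_natr.
have -> : (m + e) * n%:R = (m + e / 2) * n%:R + e / 2 * n%:R by lra.
rewrite expRD; have := expR_ge1Dx (e / 2 * n%:R).
have := expR_ge0 ((m + e / 2) * n%:R).
move: (expR (e / 2 * n%:R)) (expR _) => E' E E0 hE.
have -> : K / (e / 2) * (E * E') = K * E * ((e / 2)^-1 * E') by ring.
by rewrite ler_wpM2l ?mulr_ge0 ?(ltW K0)// ler_pdivlMl//; lra.
Qed.

(** The lower bound is asked for n > 0 because for w_0 = w_1 it is obtained only after one step of
    the cocycle. *)
Lemma exponent_limit A V m (c : R) : (fun n => A n / n%:R) @ \oo --> m -> 0 < c ->
  (forall n, (0 < n)%N -> c * expR (A n) <= V n) -> grows V m ->
  (fun n => n%:R^-1 * ln (V n)) @ \oo --> m.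
Proof.
move=> /cvgrPdist_le cA c0 AV HV; apply/cvgrPdist_le => e e0.
have e2 : 0 < e / 2 by rewrite divr_gt0.
have [N _ HN] := cA _ e2; have [K K0 HK] := HV _ e2.
pose B := `|ln c| + `|ln K|.
exists (N + (Num.truncn (B / (e / 2))).+1)%N => // n /= nN.
have n0 : (0 : R) < n%:R by rewrite ltr0n; lia.
have n1 : (0 < n)%N by lia.
have Vn0 : 0 < V n by apply: lt_le_trans (AV n n1); rewrite mulr_gt0 ?expR_gt0.
have BN : B <= e / 2 * n%:R.
  rewrite mulrC -ler_pdivrMr//; apply: le_trans (ltW (truncnS_gt _)) _.
  by rewrite ler_nat (leq_trans _ nN)// leq_addl.
have lo : ln c + A n <= ln (V n).
  by rewrite -[A n]expRK -lnM ?posrE ?expR_gt0// ler_ln ?posrE ?mulr_gt0 ?expR_gt0// AV.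
have hi : ln (V n) <= ln K + (m + e / 2) * n%:R.
  rewrite -[X in _ + X]expRK -lnM ?posrE ?expR_gt0//.
  by rewrite ler_ln ?posrE ?mulr_gt0 ?expR_gt0.
have := HN n (leq_trans (leq_addr _ _) nN).
rewrite !ler_distlC [n%:R^-1 * _]mulrC ler_pdivlMr// ler_pdivrMr// ler_pdivlMr// ler_pdivrMr//.
move=> /andP[h1 h2]; apply/andP.
have := ler_norm (ln K); have := ler_norm (- ln c); rewrite normrN => k1 k2.
have := normr_ge0 (ln K); have := normr_ge0 (ln c) => k3 k4.
by rewrite /B in BN; split; lra.
Qed.
End Growth.

(** * The cocycle in triangular coordinates *)

Section Cocycle.
Variables (R : realType) (L : nat) (rho : binary_subst L).
Local Notation C := R[i].
Local Notation normc := (ComplexField.Normc.normc).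
Local Notation mu := (@lebesgue_measure R).

Definition letter_poly (i j : 'I_2) : {poly C} :=
  \sum_(m < L | tnth (rho j) m == i) 'X^m.

Definition geo_poly : {poly C} := \sum_(m < L) 'X^m.

Lemma I2P (i : 'I_2) : i = 0 \/ i = 1.
Proof. by case: i => -[|[|//]] ?; [left|right]; apply: val_inj. Qed.

Lemma sum_letter_poly j : letter_poly 0 j + letter_poly 1 j = geo_poly.
Proof.
rewrite /geo_poly (bigID (fun m => tnth (rho j) m == 0)) /=; congr (_ + _).
by apply: eq_bigl => m; case: (I2P (tnth (rho j) m)) => ->.
Qed.

Lemma diff_letter_poly : diff_poly C rho = letter_poly 0 0 - letter_poly 0 1.
Proof.
rewrite /letter_poly big_mkcond [X in _ - X]big_mkcond /= -sumrB.
apply: eq_bigr => m _.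
by case: ifP => _; case: ifP => _; rewrite ?(subrr, subr0, sub0r, scale0r, scale1r, scaleN1r).
Qed.

Lemma fourier_matrixE x i j : fourier_matrix rho x i j = (letter_poly i j).[expi2pi x].
Proof.
rewrite mxE horner_sum; apply: eq_bigr => m _.
by rewrite hornerXn expi2piX.
Qed.

Local Notation orbit x j := (expi2pi x ^+ (L ^ j)).
Local Notation geo x j := (geo_poly.[orbit x j]).
Local Notation dif x j := ((diff_poly C rho).[orbit x j]).

Section Vector.
Variable v : 'rV[C]_2.

Definition state n (x : R) : 'rV[C]_2 := v *m cocycle rho n x.
(** A coordinate on the quotient by the invariant line spanned by (1, 1). *)
Definition transverse n x : C := state n x 0 0 - state n x 0 1.

Lemma state0 x : state 0 x = v.
Proof. by rewrite /state /cocycle big_ord0 mulmx1. Qed.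

Lemma state_mulS n x : state n.+1 x = state n x *m fourier_matrix rho (L%:R ^+ n * x).
Proof.
rewrite /state -mulmxA; congr (v *m _).
exact: big_ord_recr.
Qed.

(** With t the transverse part and y the second entry, the state is t (1, 0) + y (1, 1). The Fourier
    matrix sends (1, 0) to its row of index 0 and multiplies (1, 1) by [geo x n]. *)
Lemma stateS n x j : state n.+1 x 0 j =
  transverse n x * (letter_poly 0 j).[orbit x n] + state n x 0 1 * geo x n.
Proof.
rewrite state_mulS mxE big_ord_recl big_ord1 !fourier_matrixE.
have -> : expi2pi (L%:R ^+ n * x) = orbit x n :> C by rewrite mulrC -natrX expi2piX.
have -> : lift ord0 ord0 = 1 :> 'I_2 by apply: val_inj.
by rewrite /transverse -(sum_letter_poly j) hornerD; ring.
Qed.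

Lemma transverseS n x : transverse n.+1 x = transverse n x * dif x n.
Proof.
rewrite {1}/transverse !stateS diff_letter_poly hornerD hornerN; ring.
Qed.

Lemma normc_transverse n x :
  normc (transverse n x) = normc (v 0 0 - v 0 1) * \prod_(j < n) normc (dif x j).
Proof.
elim: n => [|n IH]; first by rewrite big_ord0 mulr1 /transverse state0.
by rewrite transverseS ComplexField.Normc.normcM IH big_ord_recr /= mulrA.
Qed.

Lemma vnorm_state n x : vnorm (state n x) = normc (state n x 0 0) + normc (state n x 0 1).
Proof.
rewrite /vnorm big_ord_recl big_ord1.
by have -> : lift ord0 ord0 = 1 :> 'I_2 by apply: val_inj.
Qed.

Lemma vnorm_state_ge n x : normc (transverse n x) <= vnorm (state n x).
Proof.
rewrite vnorm_state -[normc (state n x 0 1)](normcN _).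
exact: le_normcD.
Qed.

Lemma vnorm_state_le n x :
  vnorm (state n x) <= normc (transverse n x) + 2 * normc (state n x 0 1).
Proof.
have -> : normc (transverse n x) + 2 * normc (state n x 0 1) =
  normc (transverse n x) + normc (state n x 0 1) + normc (state n x 0 1) by ring.
rewrite vnorm_state lerD2r.
have -> : state n x 0 0 = transverse n x + state n x 0 1 by rewrite /transverse subrK.
exact: le_normcD.
Qed.

Lemma normc_letter_poly_le i j (z : C) : normc z = 1 ->
  normc (letter_poly i j).[z] <= L%:R.
Proof.
move=> z1; rewrite horner_sum big_mkcond /=.
have : normc (\sum_(m < L) (if tnth (rho j) m == i then 'X^m.[z] else 0))
   <= \sum_(m < L) 1.
  elim/big_ind2 : _ => [|a b c d h1 h2|m _].
  - by rewrite ComplexField.Normc.normc0.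
  - by apply: le_trans (le_normcD _ _) _; apply: lerD.
  - case: ifP => _; last by rewrite ComplexField.Normc.normc0.
    by rewrite hornerXn normcX z1 expr1n.
by rewrite sumr_const card_ord.
Qed.

Lemma prod_expR_ln n (F : nat -> R) : (forall j, 0 < F j) ->
  \prod_(j < n) F j = expR (\sum_(j < n) ln (F j)).
Proof.
move=> F0; rewrite expR_sum; apply: eq_bigr => j _.
by rewrite lnK// posrE.
Qed.

Definition regular_at (x : R) := (forall j, geo x j != 0) /\
  (fun n => (\sum_(j < n) ln (normc (geo x j))) / n%:R) @ \oo --> (0 : R).

(* Dividing by the product of the geo x j turns the recursion for the second
   coordinate into a sum. *)
Lemma grows_state x m : 0 <= m -> regular_at x ->
  grows (fun n => normc (transverse n x)) m ->
  grows (fun n => vnorm (state n x)) m.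
Proof.
move=> m0 [g0 gcvg] gt; pose P n := \prod_(j < n) normc (geo x j).
have gp j : 0 < normc (geo x j) by rewrite normc_gt0.
have P0 n : 0 < P n by apply: prodr_gt0.
have PE n : P n = expR (\sum_(j < n) ln (normc (geo x j))).
  exact: (prod_expR_ln n gp).
have gP : grows P 0.
  by apply: grows_le (grows_avg gcvg) => n; rewrite PE.
have gPV : grows (fun n => (P n)^-1) 0.
  apply: (@grows_le _ _ (fun n => expR (- \sum_(j < n) ln (normc (geo x j))))) => [n|].
    by rewrite PE expRN.
  apply: grows_avg; under eq_cvg do rewrite mulNr.
  by have := cvgN gcvg; rewrite oppr0 => H; exact: H.
pose Y n := normc (state n x 0 1) / P n.
pose U n := L%:R * (normc (transverse n x) * (P n.+1)^-1).
have U0 n : 0 <= U n by rewrite !mulr_ge0 ?normc_ge0 ?invr_ge0 ?(ltW (P0 _)).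
have YS n : Y n.+1 <= Y n + U n.
  rewrite /Y ler_pdivrMr// mulrDl stateS.
  have -> : U n * P n.+1 = L%:R * normc (transverse n x).
    by rewrite /U mulrA mulfVK// gt_eqF.
  have -> : normc (state n x 0 1) / P n * P n.+1 = normc (state n x 0 1) * normc (geo x n).
    by rewrite {2}/P big_ord_recr /= mulrA divfK// gt_eqF.
  apply: le_trans (le_normcD _ _) _; rewrite addrC !ComplexField.Normc.normcM lerD2l.
  rewrite mulrC ler_wpM2r ?normc_ge0//.
  by rewrite normc_letter_poly_le// normcX normc_expi2pi expr1n.
have Yle n : Y n <= Y 0%N + \sum_(i < n) U i.
  elim: n => [|n IH]; first by rewrite big_ord0 addr0.
  by apply: le_trans (YS n) _; rewrite big_ord_recr /= addrA lerD2r.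
have gU : grows U m.
  apply: growsZ => //; rewrite -[m]addr0; apply: growsM => //.
  - by move=> n; apply: normc_ge0.
  - by move=> n; rewrite invr_ge0 ltW.
  - exact: (grows_shift gPV).
have gY : grows Y m.
  by apply: grows_le Yle _; apply: growsD; [exact: grows_cst|exact: grows_sum].
apply: grows_le (fun n => vnorm_state_le n x) _; apply: growsD => //.
apply: growsZ => //; rewrite -[m]addr0.
apply: (@grows_le _ _ (fun n => Y n * P n)) => [n|].
  by rewrite /Y divfK ?gt_eqF.
apply: growsM => // n; last exact: ltW.
by rewrite divr_ge0 ?normc_ge0// ltW.
Qed.

End Vector.
End Cocycle.

(** * Exponents of the individual row vectors *)

Section Exponents.
Variables (R : realType) (L : nat) (rho : binary_subst L).
Hypothesis (L2 : (2 <= L)%N).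
Local Notation C := R[i].
Local Notation normc := (ComplexField.Normc.normc).
Local Notation mu := (@lebesgue_measure R).
Local Notation orbit x j := (expi2pi x ^+ (L ^ j)).
Local Notation geo x j := ((geo_poly R L).[orbit x j]).
Local Notation dif x j := ((diff_poly C rho).[orbit x j]).

Lemma poly_factor (p : {poly C}) : exists rs, p = lead_coef p *: \prod_(a <- rs) ('X - a%:P).
Proof. by have [rs] := closed_field_poly_normal p; exists rs. Qed.

(** The zeros of 1 + X + ... + X^(L-1) are L-th roots of unity, so its logarithmic Mahler measure is
    0. *)
Lemma ae_regular : {ae mu, forall x : R, regular_at L x}.
Proof.
have geoE : geo_poly R L = \poly_(i < L) 1.
  by rewrite /geo_poly poly_def; apply: eq_bigr => i _; rewrite scale1r.
have lead1 : lead_coef (geo_poly R L) = 1.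
  by rewrite geoE lead_coef_poly ?oner_eq0//; lia.
have [rs rsE] := poly_factor (geo_poly R L).
rewrite lead1 in rsE.
have := strong_law_poly rs L2 (oner_neq0 C).
have -> : mahler_value 1 rs = 0.
  rewrite /mahler_value ComplexField.Normc.normc1 ln1 add0r big1_seq// => a /= ars.
  suff -> : normc a = 1 by rewrite maxxx ln1.
  have ra : (geo_poly R L).[a] = 0.
    by rewrite rsE scale1r; apply/eqP; rewrite -/(root _ _) root_prod_XsubC.
  have : a ^+ L - 1 = 0.
    rewrite subrX1 (_ : \sum_(i < L) a ^+ i = (geo_poly R L).[a]) ?ra ?mulr0//.
    by rewrite -[RHS]ra /geo_poly horner_sum; apply: eq_bigr => i _; rewrite hornerXn.
  move/eqP; rewrite subr_eq0 => /eqP /(congr1 (fun z => normc z)).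
  rewrite normcX ComplexField.Normc.normc1 => /eqP.
  by rewrite pexpr_eq1 ?normc_ge0//; [move/eqP|lia].
by rewrite -rsE.
Qed.

Lemma lyapunov_real (v : 'rV[C]_2) (chi : R) :
  {ae mu, forall x : R, (forall n, (0 < n)%N -> 0 < vnorm (state rho v n x)) /\
     (fun n => n%:R^-1 * ln (vnorm (state rho v n x))) @ \oo --> chi} ->
  is_lyapunov_exponent rho v chi%:E.
Proof.
apply: ae_imp => x [V0 Vcvg].
have H : (fun n => (n%:R^-1 * ln (vnorm (state rho v n x)))%:E) @ \oo --> chi%:E.
  by apply: cvg_EFin; [exact: nearW|exact: Vcvg].
apply: (cvg_trans _ H); apply: near_eq_cvg; exists 1%N => // n n1.
by rewrite EFinM -lne_EFin//; exact: V0.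
Qed.

Lemma lyapunov_invariant (v : 'rV[C]_2) : v != 0 -> v 0 0 = v 0 1 ->
  is_lyapunov_exponent rho v 0%:E.
Proof.
move=> v0 vE; apply: lyapunov_real; apply: ae_imp ae_regular => x rx.
have [g0 gcvg] := rx.
have t0 n : transverse rho v n x = 0.
  apply: ComplexField.Normc.eq0_normc; rewrite normc_transverse vE subrr.
  by rewrite ComplexField.Normc.normc0 mul0r.
have v1 : 0 < normc (v 0 1).
  rewrite normc_gt0; apply: contra v0 => /eqP v1; apply/eqP/rowP => i; rewrite mxE.
  by case: (I2P i) => ->; rewrite ?vE.
have yE n : normc (state rho v n x 0 1) =
    normc (v 0 1) * expR (\sum_(j < n) ln (normc (geo x j))).
  elim: n => [|n IH]; first by rewrite state0 big_ord0 expR0 mulr1.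
  rewrite stateS t0 mul0r add0r ComplexField.Normc.normcM IH big_ord_recr /=.
  rewrite expRD lnK ?mulrA//.
  by rewrite posrE normc_gt0.
have lo n : normc (v 0 1) * expR (\sum_(j < n) ln (normc (geo x j))) <= vnorm (state rho v n x).
  by rewrite -yE vnorm_state lerDr normc_ge0.
split=> [n _|]; first by apply: lt_le_trans (lo n); rewrite mulr_gt0 ?expR_gt0.
apply: (exponent_limit gcvg v1) => [n _|]; first exact: lo.
apply: grows_state => //; apply: (grows_le (V := fun=> 0)); last exact: grows_cst.
by move=> n; rewrite t0 ComplexField.Normc.normc0.
Qed.

(** The transverse part, an explicit product, bounds the norm from below with rate m. The component
    along (1, 1) grows at rate at most m since m >= 0. *)
Lemma lyapunov_transverse (v : 'rV[C]_2) (m : R) : v 0 0 != v 0 1 -> 0 <= m ->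
  {ae mu, forall x : R, (forall j, dif x j != 0) /\
    (fun n => (\sum_(j < n) ln (normc (dif x j))) / n%:R) @ \oo --> m} ->
  is_lyapunov_exponent rho v m%:E.
Proof.
move=> vn m0 H; apply: lyapunov_real.
apply: ae_imp (ae_and ae_regular H) => x [rx [d0 dcvg]].
have c0 : 0 < normc (v 0 0 - v 0 1) by rewrite normc_gt0 subr_eq0.
have tE n : normc (transverse rho v n x) =
   normc (v 0 0 - v 0 1) * expR (\sum_(j < n) ln (normc (dif x j))).
  rewrite normc_transverse; congr (_ * _).
  apply: (prod_expR_ln n (F := fun j => normc (dif x j))) => j.
  by rewrite normc_gt0.
have lo n : normc (v 0 0 - v 0 1) * expR (\sum_(j < n) ln (normc (dif x j)))
    <= vnorm (state rho v n x) by rewrite -tE vnorm_state_ge.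
split=> [n _|]; first by apply: lt_le_trans (lo n); rewrite mulr_gt0 ?expR_gt0.
apply: (exponent_limit dcvg c0) => [n _|]; first exact: lo.
apply: grows_state => //.
apply: (@grows_le _ _ (fun n => normc (v 0 0 - v 0 1) *
   expR (\sum_(j < n) ln (normc (dif x j))))) => [n|]; first by rewrite tE.
by apply: growsZ; [exact: normc_ge0|exact: grows_avg].
Qed.

(** After one step the vector lies on the line of (1, 1), with coordinate S(e(x)). The coefficient
    of S at m is the entry of v at the letter in position m of w_1. As both letters occur there, S
    is non-zero, and S(e(x)) vanishes almost nowhere. *)
Lemma lyapunov_degenerate (v : 'rV[C]_2) : v != 0 -> diff_poly C rho = 0 ->
  (forall i, exists m, tnth (rho 1) m = i) ->
  is_lyapunov_exponent rho v 0%:E.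
Proof.
move=> v0 d0 occ; apply: lyapunov_real.
pose S := (v 0 0 - v 0 1) *: letter_poly R rho 0 1 + v 0 1 *: geo_poly R L.
have S0 : S != 0.
  apply: contra v0 => /eqP SE; apply/eqP/rowP => i; rewrite mxE.
  have [m mi] := occ i.
  have coefg : (geo_poly R L)`_m = 1.
    rewrite coef_sum (bigD1 m)//= coefXn eqxx big1 ?addr0// => k km.
    by rewrite coefXn (_ : (m == k :> nat) = false)//; apply/negbTE; rewrite eq_sym.
  have coefl : (letter_poly R rho 0 1)`_m = (i == 0)%:R.
    rewrite coef_sum big_mkcond (bigD1 m)//= coefXn eqxx mi big1 ?addr0.
      by case: ifP.
    move=> k km; case: ifP => // _; rewrite coefXn (_ : (m == k :> nat) = false)//.
    by apply/negbTE; rewrite eq_sym.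
  have := congr1 (fun q : {poly C} => q`_m) SE.
  rewrite coef0 coefD !coefZ coefg coefl mulr1.
  by case: (I2P i) => ->; rewrite /= ?mulr1 ?mulr0 ?add0r ?subrK.
have [rs rsE] := poly_factor S.
have lS : lead_coef S != 0 by rewrite lead_coef_eq0.
have := strong_law_poly rs L2 lS; rewrite -rsE => law.
apply: ae_imp (ae_and ae_regular law) => x [rx [Sx _]].
have [g0 gcvg] := rx.
have tS n : transverse rho v n.+1 x = 0 by rewrite transverseS d0 horner0 mulr0.
have y1 : state rho v 1 x 0 1 = S.[orbit x 0].
  rewrite stateS /transverse state0 /S hornerD !hornerZ; ring.
(* The first step contributes S instead of a geometric factor; dividing by [geo x 0] lets the
   product start at j = 0. *)
pose c := normc S.[orbit x 0] / normc (geo x 0).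
have gp j : 0 < normc (geo x j) by rewrite normc_gt0.
have c0 : 0 < c by rewrite divr_gt0 ?normc_gt0.
have yE n : normc (state rho v n.+1 x 0 1) =
    c * expR (\sum_(j < n.+1) ln (normc (geo x j))).
  elim: n => [|n IH].
    by rewrite y1 big_ord1 lnK ?posrE// /c divfK// gt_eqF.
  rewrite stateS tS mul0r add0r ComplexField.Normc.normcM IH [in RHS]big_ord_recr /=.
  rewrite expRD lnK ?mulrA//.
  by rewrite posrE.
have lo n : (0 < n)%N -> c * expR (\sum_(j < n) ln (normc (geo x j)))
    <= vnorm (state rho v n x).
  by case: n => // n _; rewrite -yE vnorm_state lerDr normc_ge0.
split=> [n n0|]; first by apply: lt_le_trans (lo n n0); rewrite mulr_gt0 ?expR_gt0.
apply: (exponent_limit gcvg c0) => [n|]; first exact: lo.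
apply: grows_state => //.
apply: (@grows_le _ _ (fun=> normc (v 0 0 - v 0 1))); last exact: grows_cst.
case=> [|n]; first by rewrite /transverse state0.
by rewrite tS ComplexField.Normc.normc0 normc_ge0.
Qed.
End Exponents.

(** * The difference polynomial and the assembly of the theorem *)

(** A letter that never occurs gives a zero row in the substitution matrix and in all its positive
    powers; the zeroth power has zeros off the diagonal. *)
Lemma primitive_occurs (L : nat) (rho : binary_subst L) (i : 'I_2) :
  primitive rho -> exists j m, tnth (rho j) m = i.
Proof.
move=> [n Hn]; apply: contrapT => no.
have row0 j : subst_matrix rho i j = 0%N.
  rewrite mxE; apply/eqP; rewrite -leqn0 leqNgt -has_count; apply/negP.
  by move=> /hasP[_ /tnthP[m ->] /eqP E]; apply: no; exists j, m.
have [j ij] : exists j : 'I_2, i != j.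
  by case: (I2P i) => ->; [exists 1|exists 0].
have := Hn i j; case: n {Hn} => [|n].
  by rewrite expr0 mxE (negbTE ij).
by rewrite exprS mxE big1// => k _; rewrite row0 mul0r.
Qed.

Lemma coef_diff_poly (A : nzRingType) (L : nat) (rho : binary_subst L) i :
  (diff_poly A rho)`_i = if insub i is Some m then
    (tnth (rho 0) m == 0)%:R - (tnth (rho 1) m == 0)%:R else 0.
Proof.
rewrite coef_sum; case: insubP => [m _ <-|iL].
  rewrite (bigD1 m)//= coefZ coefXn eqxx mulr1 big1 ?addr0// => k km.
  rewrite coefZ coefXn (_ : (m == k :> nat) = false) ?mulr0//.
  by apply/negbTE; rewrite eq_sym.
rewrite big1// => k _; rewrite coefZ coefXn (_ : (i == k :> nat) = false) ?mulr0//.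
by apply: contraNF iL => /eqP ->; apply: ltn_ord.
Qed.

Lemma coef_diff_poly_cases (A : nzRingType) (L : nat) (rho : binary_subst L) i :
  [\/ (diff_poly A rho)`_i = -1, (diff_poly A rho)`_i = 0 | (diff_poly A rho)`_i = 1].
Proof.
rewrite coef_diff_poly; case: insubP => [m _ _|_]; last by constructor 2.
case: eqP => _; case: eqP => _; rewrite ?subrr ?subr0 ?sub0r.
- by constructor 2.
- by constructor 3.
- by constructor 1.
- by constructor 2.
Qed.

Lemma map_diff_poly (F : nzRingType) (L : nat) (rho : binary_subst L) :
  map_poly (intr : int -> F) (diff_poly int rho) = diff_poly F rho.
Proof.
apply/polyP => i; rewrite coef_map_id0// !coef_diff_poly.
by case: insubP => // m _ _; rewrite rmorphB /= !rmorph_nat.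
Qed.

Lemma mup0_factor (F : fieldType) (d : {poly F}) : d != 0 ->
  d = drop_poly (mup 0 d) d * 'X^(mup 0 d) /\ (drop_poly (mup 0 d) d)`_0 != 0.
Proof.
move=> d0; set m := mup 0 d.
have low : take_poly m d = 0.
  have : ('X - 0%:P) ^+ m %| d by rewrite -mup_geq.
  rewrite subr0 => /dvdpP[q qE]; apply/polyP => i.
  by rewrite coef_take_poly coef0 qE coefMXn; case: (i < m)%N.
have dE : d = drop_poly m d * 'X^m by rewrite -[LHS](poly_take_drop m) low add0r.
split=> //; apply/negP => /eqP c0.
have : (m.+1 <= mup 0 d)%N.
  rewrite mup_geq// subr0.
  have -> : d = drop_poly 1 (drop_poly m d) * 'X^(m.+1).
    rewrite [LHS]dE exprS mulrA; congr (_ * _).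
    rewrite -[LHS](poly_take_drop 1) expr1.
    rewrite (_ : take_poly 1 _ = 0) ?add0r//.
    by apply/polyP => -[|i]; rewrite coef_take_poly coef0//= c0.
  exact: dvdp_mulIr.
by rewrite ltnn.
Qed.

Lemma ln_prod_max (R : realType) (rs : seq R[i]) :
  ln (\prod_(a <- rs) Num.max 1 (ComplexField.Normc.normc a)) =
  \sum_(a <- rs) ln (Num.max 1 (ComplexField.Normc.normc a)).
Proof.
elim: rs => [|a rs IH]; first by rewrite !big_nil ln1.
rewrite !big_cons lnM ?IH// ?posrE ?max1_gt0//.
by apply: prodr_gt0 => b _; exact: max1_gt0.
Qed.

Lemma mahler_value_ge0 (R : realType) (c : R[i]) rs :
  ComplexField.Normc.normc c = 1 -> 0 <= mahler_value c rs.
Proof.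
move=> c1; rewrite /mahler_value c1 ln1 add0r sumr_ge0// => a _.
by rewrite ln_ge0// le_max lexx.
Qed.

Theorem theorem1p1 (R : realType) (L : nat) (rho : binary_subst L)
    (hL : (2 <= L)%N) (hprim : primitive rho) :
  let p : {poly R[i]} := borwein_poly R[i] rho in
  is_borwein p /\
  exists chi_min chi_max : \bar R,
    [/\ extremal_lyapunov_exponents rho chi_min chi_max,
        chi_min = (0 : R)%:E,
        chi_max = log_mahler p &
        ~ reciprocal p ->
        forall lambda_p : R, lambda_p ^+ 3 - lambda_p - 1 = 0 ->
          ((ln lambda_p)%:E <= chi_max)%E].
Proof.
move=> p.
have one_neq0 : const_mx 1 != 0 :> 'rV[R[i]]_2.
  by apply/eqP => /rowP/(_ 0); rewrite !mxE => /eqP; rewrite oner_eq0.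
have [d0|d0] := eqVneq (diff_poly R[i] rho) 0.
  have p1 : p = 1 by rewrite /p /borwein_poly d0 eqxx.
  (* Here w_0 = w_1, so a letter occurring in either word occurs in w_1. *)
  have occ i : exists m, tnth (rho 1) m = i.
    have [j [m jm]] := primitive_occurs i hprim.
    case: (I2P j) jm => -> jm; last by exists m.
    exists m; have := coef_diff_poly R[i] rho m; rewrite d0 coef0 valK.
    rewrite -jm; case: (I2P (tnth (rho 0) m)) => ->;
      case: (I2P (tnth (rho 1) m)) => -> //= /esym/eqP;
      by rewrite ?subr0 ?sub0r ?oppr_eq0 oner_eq0.
  split.
    rewrite p1; split; first by rewrite coef1 oner_neq0.
    by move=> i; rewrite coef1; case: eqP => _; [constructor 3|constructor 2].
  have lyap0 v : v != 0 -> is_lyapunov_exponent rho v (0 : R)%:E.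
    by move=> v0; apply: lyapunov_degenerate.
  exists 0%:E, 0%:E; split => //.
  - split=> //; first by move=> v /lyap0; left.
    + by exists (const_mx 1) => //; exact: lyap0.
    + by exists (const_mx 1) => //; exact: lyap0.
  - have := @log_mahler_roots R 1 [::] (oner_neq0 _).
    rewrite big_nil scale1r p1 => ->.
    by rewrite /mahler_value big_nil ComplexField.Normc.normc1 ln1 addr0.
  - case; exists 1; first by left.
    by move=> z z0; rewrite p1 !hornerC size_poly1 expr0 !mulr1.
set d := diff_poly R[i] rho in d0.
have pE : p = drop_poly (mup 0 d) d by rewrite /p /borwein_poly -/d (negbTE d0).
have [dE p0] := mup0_factor d0; rewrite -pE in dE p0.
have pcoef i : [\/ p`_i = -1, p`_i = 0 | p`_i = 1].
  by rewrite pE coef_drop_poly; apply: coef_diff_poly_cases.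
split; first by split.
(* The same polynomial over the integers, to which Smyth's theorem applies. *)
pose P := drop_poly (mup 0 d) (diff_poly int rho).
have PE : map_poly (intr : int -> R[i]) P = p.
  apply/polyP => i; rewrite coef_map_id0// pE !coef_drop_poly.
  by rewrite /d -(map_diff_poly R[i]) coef_map_id0.
have Pcoef i : P`_i != 0 -> `|P`_i| = 1.
  rewrite coef_drop_poly.
  by case: (coef_diff_poly_cases int rho (i + mup 0 d)) => ->.
have pn0 : p != 0 by apply: contraNneq p0 => ->; rewrite coef0.
have Pn0 : P != 0 by apply: contraNneq pn0 => E; rewrite -PE E map_poly0.
have P0 : `|P`_0| = 1.
  apply: Pcoef; apply: contraNneq p0 => E; rewrite -PE coef_map_id0//.
  by rewrite E.
have Plead : `|lead_coef P| = 1 by apply: Pcoef; rewrite -lead_coefE lead_coef_eq0.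
have leadE : lead_coef p = (lead_coef P)%:~R.
  rewrite -PE lead_coef_map_inj//; exact: intr_inj.
have lead1 : ComplexField.Normc.normc (lead_coef p) = 1.
  have : lead_coef P = 1 \/ lead_coef P = -1 by lia.
  rewrite leadE; case=> ->; rewrite ?rmorphN1 ?normcN; exact: ComplexField.Normc.normc1.
have [rs rsE] := poly_factor p.
have lead0 : lead_coef p != 0 by rewrite lead_coef_eq0.
have m0 := mahler_value_ge0 rs lead1.
have mE : log_mahler p = (mahler_value (lead_coef p) rs)%:E.
  by rewrite [in LHS]rsE log_mahler_roots.
(* On the unit circle d and p differ by a power of X, which has modulus 1. *)
have law : {ae lebesgue_measure, forall x : R,
   (forall j, d.[expi2pi x ^+ (L ^ j)] != 0) /\
   (fun n => (\sum_(j < n) ln (ComplexField.Normc.normc d.[expi2pi x ^+ (L ^ j)])) / n%:R)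
       @ \oo --> mahler_value (lead_coef p) rs}.
  have := strong_law_poly rs hL lead0; rewrite -rsE; apply: ae_imp => x [px pcvg].
  have dp j : ComplexField.Normc.normc d.[expi2pi x ^+ (L ^ j)] =
      ComplexField.Normc.normc p.[expi2pi x ^+ (L ^ j)].
    rewrite dE hornerM hornerXn ComplexField.Normc.normcM !normcX normc_expi2pi.
    by rewrite !expr1n mulr1.
  split=> [j|]; first by rewrite -normc_gt0 dp normc_gt0.
  by under eq_cvg do under eq_bigr do rewrite dp.
exists 0%:E, (log_mahler p); rewrite mE; split=> //.
- split; first by rewrite lee_fin.
  + move=> v v0; have [vE|vn] := eqVneq (v 0 0) (v 0 1).
      by left; apply: lyapunov_invariant.
    by right; apply: (lyapunov_transverse _ vn m0).
  + exists (const_mx 1) => //; apply: lyapunov_invariant => //; by rewrite !mxE.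
  + have vn : (delta_mx 0 0 : 'rV[R[i]]_2) 0 0 != (delta_mx 0 0 : 'rV[R[i]]_2) 0 1.
      by rewrite !mxE /= oner_eq0.
    exists (delta_mx 0 0); last exact: (lyapunov_transverse _ vn m0).
    by apply: contraNneq vn => ->; rewrite !mxE.
- move=> nrec lam lamE; rewrite lee_fin.
  (* For lam <= 0 the value of [ln] is 0 by convention, and the Mahler measure is non-negative. *)
  have [lam0|lam0] := leP lam 0; first by rewrite ln0.
  have := @smyth R P rs lam P0 Plead.
  rewrite PE -leadE => /(_ rsE nrec lamE) lamM.
  rewrite /mahler_value lead1 ln1 add0r -ln_prod_max ler_ln// ?posrE//.
  by apply: lt_le_trans lamM.
Qed.
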